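(* Fix integers $0<k<n$ and partitions $\mu\subseteq\lambda$ contained in the $k\times(n-k)$ rectangle. For every partition $\nu$, the number of ways to apply Algorithm 1 (described in the context) to the skew diagram $\lambda/\mu$ and finish with a diagram of shape $\nu$ equals the Littlewood–Richardson coefficient $c_{\mu\nu}^{\lambda}$.
   Context: Boxes are positions $(i,j)$ in a grid, $i$ the row (counted from the top), $j$ the column (counted from the left), $1\le i\le k$, $1\le j\le n-k$. The Young diagram of a partition $\lambda$ is the set of boxes $(i,j)$ with $j\le\lambda_i$; for $\mu\subseteq\lambda$ the skew diagram $\lambda/\mu$ is the set of boxes in $\lambda$ but not in $\mu$. A diagram is any set of boxes. For a diagram $D$, let $(i,l_i)$ and $(i,r_i)$ be the leftmost and rightmost boxes of $D$ in row $i$; if row $i$ of $D$ is empty set $l_i=\infty$, $r_i=0$. Algorithm 1 (nondeterministic). Input: $D=\lambda/\mu$. While there exists $i>1$ with $l_{i-1}>l_i$: take the maximal such $i$. Step A is allowed if $r_i\ge l_{i-1}-1$ or row $i-1$ is empty; Step B is allowed if $r_i\le r_{i-1}-1$; if both are allowed, one of them is chosen. Step A: for each $j'$ with $l_i\le j'<l_{i-1}$, exchange the membership in $D$ of boxes $(i,j')$ and $(i-1,j')$ (i.e. the box of $D$ at $(i,j')$ moves to $(i-1,j')$ and vice versa). Step B: for each $i'\ge i$ with $l_{i'}=l_i$, remove box $(i',l_{i'})$ from $D$ and add box $(i',r_{i'}+1)$. Final step: once $l_1\le l_2\le\cdots$ (the $l_i$ are weakly increasing), shift all boxes in each row as far right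 as possible; the result is the Young diagram of a partition $\nu$ justified to the northeast (row $i$ has $\nu_i$ boxes). A ''way to apply the algorithm'' is a complete sequence of choices, and the number of ways ending at $\nu$ is the number of such sequences producing $\nu$. $c^{\lambda}_{\mu\nu}$ denotes the Littlewood–Richardson coefficient, i.e. the structure constant $\sigma_\mu\smile\sigma_\nu=\sum_\lambda c^\lambda_{\mu\nu}\sigma_\lambda$ for Schubert classes in $H^*(G(k,n))$ (equivalently, the number of semistandard skew tableaux of shape $\lambda/\mu$ and weight $\nu$ whose reverse reading word is a ballot sequence). *)

(* Defs.v *)
From mathcomp Require Import all_boot.
From mathcomp Require Export classical_sets cardinality.

Set Implicit Arguments.
Unset Strict Implicit.
Unset Printing Implicit Defensive.

Definition is_partition (la : seq nat) : bool :=
  sorted geq la && all (fun x => 0 < x) la.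

(* la_i with i counted from 1; it is 0 past the last part. *)
Definition part (la : seq nat) (i : nat) : nat := nth 0 la i.-1.

Definition part_included (mu la : seq nat) : Prop :=
  forall i, 0 < i -> part mu i <= part la i.

Definition in_rectangle (k m : nat) (la : seq nat) : bool :=
  (size la <= k) && all (fun x => x <= m) la.

(* The grid has k rows and m columns (m = n - k). The ordinals are counted from
   0, but every index i, j, l_i, r_i below is counted from 1, through the
   coordinates row and col. *)
Definition box (k m : nat) : finType := ('I_k * 'I_m)%type.
Definition diagram (k m : nat) : finType := {set box k m}.

Definition row (k m : nat) (b : box k m) : nat := b.1.+1.
Definition col (k m : nat) (b : box k m) : nat := b.2.+1.

Definition skew_diagram (k m : nat) (la mu : seq nat) : diagram k m :=
  [set b : box k m | part mu (row b) < col b <= part la (row b)].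

Section Algorithm.

Variables k m : nat.
Implicit Types (D : diagram k m) (i j : nat) (b : box k m) (nu : seq nat).

Definition has_box D i j : bool :=
  [exists b in D, (row b == i) && (col b == j)].

Definition row_empty D i : bool := [forall b in D, row b != i].

(* l_i; for an empty row the value is m.+1, larger than any column, which plays
   the role of infinity. *)
Definition lft D i : nat := \big[minn/m.+1]_(b in D | row b == i) col b.

(* r_i; 0 for an empty row. *)
Definition rgt D i : nat := \max_(b in D | row b == i) col b.

Definition descent D i : bool := (1 < i <= k) && (lft D i < lft D i.-1).

Definition finished D : bool := [forall i : 'I_k.+1, ~~ descent D i].

Definition pivot D : nat := \max_(i < k.+1 | descent D i) i.

Inductive step := StepA | StepB.

Definition allowed (c : step) D i : bool :=
  match c with
  | StepA => (lft D i.-1 <= (rgt D i).+1) || row_empty D i.-1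
  | StepB => rgt D i < rgt D i.-1
  end.

Definition stepA D i : diagram k m :=
  [set b : box k m |
     if lft D i <= col b < lft D i.-1 then
       if row b == i then has_box D i.-1 (col b)
       else if row b == i.-1 then has_box D i (col b)
       else b \in D
     else b \in D].

Definition stepB D i : diagram k m :=
  [set b : box k m |
     if (i <= row b) && (lft D (row b) == lft D i) then
       ((b \in D) && (col b != lft D (row b)))
       || (col b == (rgt D (row b)).+1)
     else b \in D].

Definition do_step (c : step) D i : diagram k m :=
  match c with StepA => stepA D i | StepB => stepB D i end.

(* The boxes of each row are packed into the last columns of the grid. *)
Definition shift_right D : diagram k m :=
  [set b : box k m | m < col b + #|[set b' in D | row b' == row b]| ].

Definition ne_young_diagram nu : diagram k m :=
  [set b : box k m | m < col b + part nu (row b)].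

Definition has_ne_shape D nu : bool :=
  in_rectangle k m nu && (D == ne_young_diagram nu).

(* s is a complete sequence of choices for the algorithm started at D, ending
   at the partition nu. Forced steps are recorded in s as well; this does not
   change the number of sequences. *)
Fixpoint is_way nu D (s : seq step) : bool :=
  match s with
  | [::] => finished D && has_ne_shape (shift_right D) nu
  | c :: s' =>
      [&& ~~ finished D, allowed c D (pivot D)
        & is_way nu (do_step c D (pivot D)) s']
  end.

Definition ways nu D : set (seq step) := (fun s => is_way nu D s).

End Algorithm.

Section LittlewoodRichardson.

Variables (k m N : nat) (D : diagram k m).

(* A filling of D with entries 1, ..., N is encoded as a function on the whole
   grid that takes the value 0 exactly outside D. *)
Definition filling : finType := {ffun box k m -> 'I_N.+1}.
Implicit Type T : filling.

Definition semistandard T : bool :=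
  [&& [forall b, (b \in D) == (0 < T b)],
      [forall b in D, forall b' in D,
         ((row b == row b') && (col b <= col b')) ==> (T b <= T b')]
    & [forall b in D, forall b' in D,
         ((col b == col b') && (row b < row b')) ==> (T b < T b')]].

Definition has_weight T (nu : seq nat) : bool :=
  [forall v : 'I_N.+1, (0 < v) ==> (#|[set b in D | T b == v]| == part nu v)].

(* The rows from top to bottom, each of them from right to left. *)
Definition reverse_reading_word T : seq nat :=
  [seq val (T b)
     | b <- [seq (i, j) | i <- enum 'I_k, j <- rev (enum 'I_m)] & b \in D].

(* Every prefix contains at least as many v - 1 as v, for v > 1; only the v
   that occur in w matter. *)
Definition ballot (w : seq nat) : bool :=
  all (fun p => all (fun v => (1 < v) ==>
         (count_mem v (take p w) <= count_mem v.-1 (take p w))) w)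
      (iota 0 (size w).+1).

End LittlewoodRichardson.

(* The bound size nu on the entries is no restriction, since the weight is nu. *)
Definition lr_coef (k m : nat) (la mu nu : seq nat) : nat :=
  let D := skew_diagram k m la mu in
  #|[set T : filling k m (size nu) |
       [&& semistandard D T, has_weight D T nu
         & ballot (reverse_reading_word D T)]]|.

(* Main.v *)
From HB Require Import structures.
From mathcomp Require Import all_boot fingroup perm ssralg ssrint matrix finmap.
From mathcomp Require Import boolp classical_sets functions cardinality zify.
Require Import Defs.
Set Implicit Arguments.
Unset Strict Implicit.
Unset Printing Implicit Defensive.

(* A Littlewood-Richardson tableau of shape la/mu is recorded by the
   Gelfand-Tsetlin pattern f whose entry f i u counts the letters u.+1 in its
   first i rows.  The ballot condition becomes the interlacing of consecutive
   levels, and column strictness becomes a bound (column_bound) on three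
   consecutive levels.

   Reading the rows from the bottom instead, Algorithm 1 builds level t.+1 of
   such a pattern for the skew shape rotated by 180 degrees while it sorts the
   row k - t.+1 into the rows below it.  When the row being inserted starts in
   column a and meets a row starting in column c, Step A decides that the next
   entry of the level exceeds its least possible value by exactly a - c, and
   Step B that it exceeds it by less.  So the complete sequences of choices are
   in bijection with the patterns of the rotated shape.

   The two numbers of patterns agree: summing over all patterns of top row nu,
   a sign-reversing involution (a Bender-Knuth reflection of one level, applied
   to the columns left of the first violation of column_bound) writes the number
   of those for la/mu as the signed sum of the weight multiplicities
   K(nu, w(la + rho) - (mu + rho)), and this expression is invariant under the
   rotation because K(nu, -) is symmetric. *)

(** * Gelfand-Tsetlin patterns *)

(** A pattern is also a semistandard tableau of shape [nu] with letters at most [k], whose letters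
    at most [i] fill the shape [f i]. In this companion tableau [column_bound] says that [mu] plus
    the content of the columns right of [J] is a partition, for every [J]; the involution is
    Stembridge's, and no pattern has to be carried from one shape to the other. The rotation comes
    in because the algorithm treats the bottom row first, so the contents of its levels are the row
    lengths in reverse order.

    The obstacle in the run is that Steps A and B look only at row ends, whereas [column_bound]
    compares three levels. It is overcome because left ends store what is needed of the levels
    already built. For entry [u] of level [t.+1], let [y] be its excess:
    [psum (f t.+1) u.+1 - psum (f t) u] minus the length of the inserted row. The bound coming from
    the level before takes the form [y <= a - c], with [a] the left end of the inserted row and [c]
    that of the row carrying entry [u] of level [t]. Step B moves [c] by one and so lowers this
    bound by one; Step A makes it an equality. *)

Definition psum (f : nat -> nat) (v : nat) : nat := \sum_(u < v) f u.

Lemma psum0 f : psum f 0 = 0.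
Proof. by rewrite /psum big_ord0. Qed.

Lemma psumS f v : psum f v.+1 = psum f v + f v.
Proof. by rewrite /psum big_ord_recr. Qed.

Lemma eq_psum f g v : (forall u, u < v -> f u = g u) -> psum f v = psum g v.
Proof. by move=> e; apply: eq_bigr => u _; apply: e. Qed.

Lemma psum_stable f K v :
  (forall u, K <= u -> f u = 0) -> K <= v -> psum f v = psum f K.
Proof.
move=> f0; elim: v => [|v IH]; first by case: K {f0}.
rewrite leq_eqVlt => /predU1P[-> //|]; rewrite ltnS => lKv.
by rewrite psumS IH // f0 // addn0.
Qed.

Lemma leq_psum2 f v w : v <= w -> psum f v <= psum f w.
Proof.
by move=> /subnK<-; elim: (w - v) => [|d IH] //; rewrite addSn psumS; lia.
Qed.

Lemma leq_psum f g v : (forall u, f u <= g u) -> psum f v <= psum g v.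
Proof. by move=> h; apply: leq_sum. Qed.

Lemma subn_minn x J : x - J + minn x J = x.
Proof. by rewrite minnE addnC subnK // leq_subr. Qed.

Definition pattern := nat -> nat -> nat.

Definition gt_pattern (k : nat) (nu : nat -> nat) (f : pattern) : Prop :=
  [/\ forall u, f 0 u = 0, forall u, f k u = nu u
    & forall i u, i < k -> f i u <= f i.+1 u /\ f i.+1 u.+1 <= f i u].

Definition has_content (k K : nat) (mu la : nat -> nat) (f : pattern) : Prop :=
  forall i, i < k -> psum (f i.+1) K + mu i = psum (f i) K + la i.

(** Written without subtraction: the letters at most [v.+1] of row [i.+1] end no further right than
    the letters at most [v] of row [i]. *)
Definition column_bound (mu : nat -> nat) (f : pattern) (i : nat) : Prop :=
  forall v, psum (f i.+2) v.+1 + psum (f i) v + mu i.+1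
            <= psum (f i.+1) v.+1 + psum (f i.+1) v + mu i.

Definition lr_pattern k K mu la nu f : Prop :=
  [/\ gt_pattern k nu f, has_content k K mu la f
    & forall i, i.+1 < k -> column_bound mu f i].

Section Patterns.
Variables (k K M : nat).

(** Patterns are total functions, which keeps index arithmetic simple; they are counted through this
    finite copy, which loses nothing on [boxed] ones. *)
Definition fpattern : finType := {ffun 'I_k.+1 * 'I_K -> 'I_M.+1}.

Definition pat_of (g : fpattern) : pattern := fun i u =>
  if insub i is Some i' then if insub u is Some u' then val (g (i', u')) else 0
  else 0.

Definition of_pat (f : pattern) : fpattern := [ffun x : 'I_k.+1 * 'I_K => inord (f x.1 x.2)].

Definition boxed (f : pattern) : Prop :=
  forall i u, f i u <= M /\ (~~ ((i <= k) && (u < K)) -> f i u = 0).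

Lemma pat_of_boxed g : boxed (pat_of g).
Proof.
move=> i u; rewrite /pat_of; case: insubP => [i' hi _|hi]; last by split.
case: insubP => [u' hu _|hu]; last by split.
split; first by rewrite -ltnS ltn_ord.
by rewrite -ltnS hi hu.
Qed.

Lemma of_patK f : boxed f -> pat_of (of_pat f) = f.
Proof.
move=> bf; apply: funext => i; apply: funext => u; rewrite /pat_of.
have [b0 b1] := bf i u.
case: insubP => [i' hi ei|hi]; last by rewrite b1 // -ltnS negb_and hi.
case: insubP => [u' hu eu|hu]; last by rewrite b1 // -ltnS negb_and hu orbT.
by rewrite ffunE /= inordK ?ei ?eu //.
Qed.

Lemma pat_ofK : cancel pat_of of_pat.
Proof.
move=> g; apply/ffunP => -[i u]; rewrite ffunE /pat_of /=.
by rewrite !valK; apply: val_inj; rewrite /= inordK.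
Qed.

Definition nb_patterns (P : pattern -> Prop) : nat :=
  #|[set g : fpattern | `[< P (pat_of g) >]]|.

Variable nu : nat -> nat.
Hypothesis nuM : forall u, nu u <= M.
Hypothesis nuK : forall u, K <= u -> nu u = 0.
Notation GT := (gt_pattern k nu).

Lemma gt_pattern_mono f : GT f -> forall i j u, i <= j <= k -> f i u <= f j u.
Proof.
move=> [_ _ h] i j u /andP[/subnK<-]; elim: (j - i) => [|d IH] //= hd.
by have := IH _; have := h (d + i) u; rewrite addSn in hd *; lia.
Qed.

Lemma gt_pattern_le f : GT f -> forall i u, i <= k -> f i u <= nu u.
Proof.
move=> hf i u ik; have [_ <- _] := hf.
by apply: gt_pattern_mono => //; rewrite ik leqnn.
Qed.

Definition level_excess (f : pattern) (i J : nat) : nat :=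
  psum (fun u => f i u - J) K.

(* The Bender-Knuth reflection of level [lv], applied only to the columns up to
   [J]: [toggle_top] is the upper end of the interval allowed by the
   neighbouring levels. *)
Definition toggle_top (f : pattern) lv J u : nat :=
  if u is u'.+1 then minn (minn (f lv.+1 u) J) (minn (f lv.-1 u') J)
  else minn (f lv.+1 0) J.

Definition toggle (lv J : nat) (f : pattern) : pattern := fun i u =>
  if i == lv then
    (f lv u - J) + (maxn (minn (f lv.+1 u.+1) J) (minn (f lv.-1 u) J)
                    + toggle_top f lv J u - minn (f lv u) J)
  else f i u.

(** Under this condition the first [J] columns of every row of level [lv] longer than [J] are forced
    by level [lv.-1], so the truncated reflection fixes these rows and can be glued to the untouched
    part right of [J]. *)
Definition frozen_above (f : pattern) lv J : Prop :=
  forall u, J < f lv u -> J < f lv.-1 u.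

(** * The truncated Bender-Knuth reflection *)

Section Toggle.
Variables (f : pattern) (i J : nat).
Hypotheses (ik : i.+1 < k) (gtf : GT f) (fz : frozen_above f i.+1 J).
Let g := toggle i.+1 J f.

Lemma toggle_other j u : j != i.+1 -> g j u = f j u.
Proof. by rewrite /g /toggle => /negbTE->. Qed.

Let lo u := maxn (minn (f i.+2 u.+1) J) (minn (f i u) J).
Let hi u := toggle_top f i.+1 J u.

Lemma toggle_level u : g i.+1 u = f i.+1 u - J + (lo u + hi u - minn (f i.+1 u) J).
Proof. by rewrite /g /toggle eqxx. Qed.

Lemma toggle_lo u : lo u <= minn (f i.+1 u) J.
Proof.
have [_ _ h] := gtf; have [h1 _] := h i u (ltnW ik); have [_ h2] := h i.+1 u ik.
by rewrite /lo geq_max !leq_min !geq_minr !geq_min h1 h2.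
Qed.

Lemma toggle_hi u : minn (f i.+1 u) J <= hi u.
Proof.
have [_ _ h] := gtf; have [h1 _] := h i.+1 u ik.
have w x y : x <= y -> minn x J <= minn y J.
  by move=> xy; rewrite leq_min geq_minr geq_min xy.
rewrite /hi; case: u h1 => [|u] h1 /=; first exact: w.
have [_ h2] := h i u (ltnW ik).
by rewrite leq_min !w.
Qed.

Lemma toggle_hiJ u : hi u <= J.
Proof.
by rewrite /hi; case: u => [|u] /=; [apply: geq_minr|rewrite geq_min geq_minr].
Qed.

Lemma toggle_frozen u : J < f i.+1 u -> lo u = J /\ hi u = J.
Proof.
move=> Jf; have /= Jf' := fz Jf; have e : minn (f i.+1 u) J = J by apply/minn_idPr/ltnW.
have := toggle_hi u; have := toggle_hiJ u; rewrite e => h1 h2.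
split; last by apply/eqP; rewrite eqn_leq h1 h2.
have := toggle_lo u; rewrite e => h3; apply/eqP; rewrite eqn_leq h3 /=.
by rewrite /lo leq_max !leq_min leqnn !andbT (ltnW Jf') orbT.
Qed.

Lemma toggle_low u : f i.+1 u <= J -> f i.+2 u.+1 <= lo u /\ f i u <= lo u.
Proof.
move=> fJ; have [_ _ h] := gtf.
have [h1 _] := h i u (ltnW ik); have [_ h2] := h i.+1 u ik.
by rewrite /lo !leq_max !leq_min !leqnn (leq_trans h1 fJ) (leq_trans h2 fJ) orbT.
Qed.

Lemma toggle_high u : hi u <= f i.+2 u /\ hi u.+1 <= f i u.
Proof. by rewrite /hi; split; case: u => [|u] /=; rewrite !geq_min ?leqnn ?orbT. Qed.

Lemma toggle_levelP u :
  J < f i.+1 u /\ g i.+1 u = f i.+1 u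
  \/ [/\ f i.+1 u <= J, g i.+1 u + f i.+1 u = lo u + hi u,
        lo u <= f i.+1 u & f i.+1 u <= hi u].
Proof.
rewrite toggle_level; case: (leqP (f i.+1 u) J) => fJ.
  have e : minn (f i.+1 u) J = f i.+1 u by apply/minn_idPl.
  right; have := toggle_lo u; have := toggle_hi u; rewrite e => h1 h2; split=> //.
  by move: h1 h2; lia.
by left; split=> //; have [-> ->] := toggle_frozen fJ; move: fJ; clear; lia.
Qed.

Lemma toggle_gt : GT g.
Proof.
have [h0 hk h] := gtf; split=> [u|u|j u jk].
- by rewrite toggle_other.
- by rewrite toggle_other // gtn_eqF.
have [h1 h2] := h j u jk.
case: (eqVneq j i.+1) => [ej|ji].
  rewrite ej in h1 h2 *; rewrite !(toggle_other (j := i.+2)) ?eqSS ?(gtn_eqF (ltnSn _)) //.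
  have [t1 t2] := toggle_high u.
  case: (toggle_levelP u) => [[_ ->]//|[fJ e l1 l2]].
  by have [t3 t4] := toggle_low fJ; lia.
rewrite !(toggle_other (j := j)) //.
case: (eqVneq j i) => [ej|ji']; last by rewrite !toggle_other // eqSS.
rewrite ej in h1 h2 *; split.
  case: (toggle_levelP u) => [[_ ->]//|[fJ e l1 l2]].
  by have [t3 t4] := toggle_low fJ; lia.
have [_ t2] := toggle_high u.
by case: (toggle_levelP u.+1) => [[_ ->]//|[fJ e l1 l2]]; lia.
Qed.

Lemma toggle_above J' j u : J <= J' -> g j u - J' = f j u - J'.
Proof.
move=> JJ; case: (eqVneq j i.+1) => [->|ji]; last by rewrite toggle_other.
have := toggle_hiJ u.
by case: (toggle_levelP u) => [[_ ->]//|[fJ e l1 l2]]; lia.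
Qed.

Lemma toggleK : toggle i.+1 J g = f.
Proof.
apply: funext => j; apply: funext => u; rewrite {1}/toggle.
case: (eqVneq j i.+1) => [->|ji]; last by rewrite toggle_other.
have e1 v : g i.+2 v = f i.+2 v by rewrite toggle_other // eqSS gtn_eqF.
have e2 v : g i v = f i v by rewrite toggle_other // ltn_eqF.
have -> : toggle_top g i.+1 J u = hi u by rewrite /hi /toggle_top /=; case: u => [|u]; rewrite !e1 ?e2.
rewrite /= !e1 !e2 -/(lo u); have hJ := toggle_hiJ u.
case: (toggle_levelP u) => [[fJ ->]|[fJ e l1 l2]].
  have [-> ->] := toggle_frozen fJ; have -> : minn (f i.+1 u) J = J; first by apply/minn_idPr/ltnW.
  by move: fJ; lia.
have -> : minn (g i.+1 u) J = g i.+1 u; first by apply/minn_idPl; move: e l1 hJ; lia.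
by move: e l1 l2 hJ; lia.
Qed.

Lemma toggle_excess J' j : J <= J' -> level_excess g j J' = level_excess f j J'.
Proof. by move=> JJ; apply: eq_psum => u _; apply: toggle_above. Qed.

(* [maxn x y + minn x y = x + y] makes the sum of the interval ends telescope. *)
Lemma toggle_sum :
  psum (g i.+1) K + psum (f i.+1) K + level_excess f i J + level_excess f i.+2 J
  = psum (f i) K + psum (f i.+2) K + 2 * level_excess f i.+1 J.
Proof.
have fK j : j <= k -> f j K = 0.
  by move=> jk; apply/eqP; rewrite -leqn0 -(nuK (leqnn K)) gt_pattern_le.
(* Partial sums do not balance exactly: the upper end [hi v] of the next interval and
   [minn (f i.+2 v) J] remain as boundary terms, and both vanish at [v = K]. *)
suff H v : psum (g i.+1) v + psum (f i.+1) v + psum (fun u => f i u - J) v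
           + psum (fun u => f i.+2 u - J) v + hi v
         = psum (f i) v + psum (f i.+2) v + 2 * psum (fun u => f i.+1 u - J) v
           + minn (f i.+2 v) J.
  have := H K; have [] := toggle_high K; rewrite /level_excess (fK i.+2) // min0n leqn0 => /eqP-> _.
  by rewrite !addn0.
elim: v => [|v IH]; first by rewrite !psum0 /hi /=.
have s1 := subn_minn (f i.+1 v) J; have s2 := subn_minn (f i.+2 v) J; have s3 := subn_minn (f i v) J.
have mm : lo v + hi v.+1 = minn (f i.+2 v.+1) J + minn (f i v) J.
  by rewrite /lo /hi /= addnC addn_min_max.
have l1 := toggle_hi v.
rewrite !psumS toggle_level; set x := minn (f i.+1 v) J in s1 l1 *.
set y := minn (f i.+2 v) J in IH s2 *; set z := minn (f i v) J in s3 mm.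
set w := minn (f i.+2 v.+1) J in mm *.
move: IH s1 s2 s3 mm l1; clearbody x y z w lo hi; clear; lia.
Qed.

End Toggle.
End Patterns.

(** Together with [psum_sub_eq] this is a conjugate duality: for weakly decreasing [f], the partial
    sum [psum f v] is the minimum over [J] of the excess above [J] plus [v * J], attained at
    [J = f v]. It turns conditions indexed by rows into conditions indexed by columns. *)
Lemma psum_sub_ge f J v V : v <= V -> psum f v <= psum (fun u => f u - J) V + v * J.
Proof.
move=> vV; apply: (@leq_trans (psum (fun u => f u - J) v + v * J)); last first.
  by rewrite leq_add2r leq_psum2.
by elim: v {vV} => [|v IH]; rewrite ?psum0 ?psumS //; lia.
Qed.

Lemma psum_sub_eq f J v V : v <= V -> (forall u, u < v -> J <= f u) ->
  (forall u, v <= u -> f u <= J) -> psum (fun u => f u - J) V + v * J = psum f v.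
Proof.
move=> vV h1 h2; rewrite (@psum_stable _ v) //; last by move=> u /h2; lia.
elim: v {vV h2} h1 => [|v IH] h1; rewrite ?psum0 ?psumS //.
by have := IH (fun u uv => h1 u (leqW uv)); have := h1 v (leqnn _); lia.
Qed.

Lemma psum_eq_pointwise a b v : (forall u, a u <= b u) -> psum a v = psum b v ->
  forall u, u < v -> a u = b u.
Proof.
move=> h; elim: v => [|v IH] //; rewrite !psumS => e u.
have := leq_psum v h; have := h v => h1 h2.
rewrite ltnS leq_eqVlt => /predU1P[->|uv]; first by lia.
by apply: IH => //; lia.
Qed.

Lemma psum_sub_last f J q V : q < V -> (forall u, u < q -> J <= f u) ->
  (forall u, q < u -> f u <= J) ->
  psum (fun u => f u - J) V + q * J = psum f q + (f q - J).
Proof.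
move=> qV h1 h2; rewrite (@psum_stable _ q.+1) //; last by move=> u /h2; lia.
rewrite psumS; suff: psum (fun u => f u - J) q + q * J = psum f q by lia.
elim: q {qV h2} h1 => [|q IH] h1; rewrite ?psum0 ?psumS //.
by have := IH (fun u uv => h1 u (leqW uv)); have := h1 q (leqnn _); lia.
Qed.

(** * Column bounds as conditions on the columns of the companion tableau *)

Section Failures.
Variables (k K : nat) (nu mu : nat -> nat).
Hypothesis nuK : forall u, K <= u -> nu u = 0.
Notation GT := (gt_pattern k nu).
Notation H := (level_excess K).

(** [H f i.+1 J - H f i J] counts the letters [i.+1] right of column [J] in the companion tableau; a
    failure means that these contents, added to [mu], increase from index [i] to index [i.+1]. *)
Definition fails (f : pattern) i J : Prop :=
  mu i + 2 * H f i.+1 J < mu i.+1 + H f i J + H f i.+2 J.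

Lemma gt_pattern_out f i u : GT f -> i <= k -> K <= u -> f i u = 0.
Proof.
by move=> gf ik Ku; apply/eqP; rewrite -leqn0 -(nuK Ku) (gt_pattern_le gf).
Qed.

Lemma level_excessE f i J V : GT f -> i <= k -> K <= V ->
  H f i J = psum (fun u => f i u - J) V.
Proof.
move=> gf ik KV; rewrite /level_excess; symmetry; apply: psum_stable => // u Ku.
by rewrite (gt_pattern_out gf).
Qed.

Lemma gt_pattern_anti f i u : GT f -> i <= k -> f i u.+1 <= f i u.
Proof.
by move=> [h0 _ h]; case: i => [|i] ik; rewrite ?h0 //; have := h i u ik; lia.
Qed.

Lemma gt_pattern_antiW f i u v : GT f -> i <= k -> u <= v -> f i v <= f i u.
Proof.
move=> gf ik /subnK<-; elim: (v - u) => [|d IH] //.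
by rewrite addSn; apply: leq_trans (gt_pattern_anti _ gf ik) IH.
Qed.

(** The bound at [v] comes from the column [J = f i.+1 v]. Conversely, if [q] parts of level [i.+1]
    exceed [J], the bounds at [q] and [q.-1] suffice, because interlacing leaves a single part of
    level [i.+2] and a single part of level [i] whose position relative to [J] is open. *)
Lemma column_boundP f i : GT f -> i.+1 < k -> mu i.+1 <= mu i ->
  (forall J, ~ fails f i J) <-> column_bound mu f i.
Proof.
move=> gf ik muS; have [_ _ h] := gf; split=> hE.
  move=> v; set J := f i.+1 v.
  have := hE J; rewrite /fails; set V := maxn K v.+1.
  have KV : K <= V by lia.
  have vV : v.+1 <= V by lia.
  rewrite !(@level_excessE _ _ _ V) //; try lia.
  have := psum_sub_ge (f i.+2) J vV.
  have := psum_sub_ge (f i) J (ltnW vV).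
  have -> : psum (f i.+1) v.+1 = psum (f i.+1) v + J by rewrite psumS.
  have <- := @psum_sub_eq (f i.+1) J v V (ltnW vV).
  - lia.
  - by move=> u uv; apply: (gt_pattern_antiW gf); lia.
  - by move=> u uv; apply: (gt_pattern_antiW gf); lia.
move=> J; rewrite /fails.
have ex : exists u, f i.+1 u <= J by exists K; rewrite (gt_pattern_out gf) //; lia.
case: (ex_minnP ex) => q hq qmin.
have lo u : u < q -> J < f i.+1 u.
  by move=> uq; rewrite ltnNge; apply/negP => /qmin; lia.
have hi u : q <= u -> f i.+1 u <= J.
  by move=> uq; apply: leq_trans hq; apply: (gt_pattern_antiW gf); lia.
set V := maxn K q.+1.
have KV : K <= V by lia.
have qV : q.+1 <= V by lia.
rewrite !(@level_excessE _ _ _ V) //; try lia.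
have e1 := @psum_sub_eq (f i.+1) J q V (ltnW qV) (fun u uq => ltnW (lo u uq)) hi.
have e2 : psum (fun u => f i.+2 u - J) V + q * J = psum (f i.+2) q + (f i.+2 q - J).
  apply: psum_sub_last => // u uq; first by have := lo u uq; have := h i.+1 u ik; lia.
  by case: u uq => // u qu; have := h i.+1 u ik; have := hi u; lia.
have Eq := hE q; rewrite !psumS in Eq.
case eq: q => [|q'].
  have -> : psum (fun u => f i u - J) V = 0.
    rewrite (@psum_stable _ 0) ?psum0 // => u _; have := h i u; have := hi u; lia.
  move: e1 e2 Eq; rewrite eq !psum0; have := hi q; rewrite eq; lia.
have e3 : psum (fun u => f i u - J) V + q' * J = psum (f i) q' + (f i q' - J).
  apply: psum_sub_last => [|u uq|u uq]; first by lia.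
    by have := h i u; have := lo u.+1; lia.
  by have := h i u; have := hi u; lia.
have Eq' := hE q'; have := lo q'; have := h i q'; have := h i.+1 q.
have := h i.+1 q'; have := hi q.
move: e1 e2 Eq Eq'; rewrite eq !psumS; lia.
Qed.

(** Passing from [J.+1] to [J] adds one column, of height [psum (n j) K] at level [j], and each
    level contributes at most one box to it. A new failure needs a column with a letter [i.+2] and
    no letter [i.+1]: the deficit is then exactly one, and the equal heights at levels [i] and
    [i.+1] freeze the rows beyond [J]. *)
Lemma fails_drop f i J : GT f -> i.+1 < k -> ~ fails f i J.+1 -> fails f i J ->
  mu i + 2 * H f i.+1 J + 1 = mu i.+1 + H f i J + H f i.+2 J
  /\ frozen_above f i.+1 J.
Proof.
move=> gf ik; rewrite /fails; have [_ _ h] := gf.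
pose n j u : nat := J < f j u.
have HJ j : H f j J = H f j J.+1 + psum (n j) K.
  rewrite /level_excess /n; elim: (K) => [|v IH]; rewrite ?psum0 // !psumS; lia.
have n1 : psum (n i) K <= psum (n i.+1) K.
  by apply: leq_psum => u; rewrite /n; have := h i u; lia.
have n3 : psum (n i.+2) K <= psum (n i.+1) K + 1.
  have : psum (n i.+2) K.+1 <= psum (n i.+1) K + 1.
    elim: (K) => [|v IH]; first by rewrite psumS !psum0 /n; lia.
    by rewrite psumS [X in _ <= X + _]psumS; move: IH; rewrite /n; have := h i.+1 v; lia.
  by apply: leq_trans; apply: leq_psum2.
rewrite !HJ => h1 h2; split; first by lia.
move=> u; case: (leqP K u) => uK; first by rewrite (gt_pattern_out gf) //; lia.
have := @psum_eq_pointwise (n i) (n i.+1) K; rewrite /n => hp.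
have: (J < f i u) = (J < f i.+1 u) :> nat.
  by apply: hp => // [w|]; [have := h i w; lia | rewrite -/(n i) -/(n i.+1); lia].
by move=> /= e1; lia.
Qed.

End Failures.

(** * Rotation symmetry *)

Import GRing.Theory.

Section Alternants.
Variable k : nat.
Implicit Types (x y : {ffun 'I_k -> nat}) (s : 'S_k).

Definition permute s x : {ffun 'I_k -> nat} := [ffun i => x (s i)].

(** For [y] with distinct entries this is the sign of the permutation matching [x] with [y], and
    zero if there is none. The determinant form makes the antisymmetry in [x] immediate. *)
Definition alternant y x : int :=
  (\det (\matrix_(i, j) (x i == y j)%:R : 'M_k))%R.

Lemma alternant_tperm y x i j : i != j ->
  alternant y (permute (tperm i j) x) = (- alternant y x)%R.
Proof.
move=> ij; rewrite /alternant.
have -> : (\matrix_(i0, j0) (permute (tperm i j) x i0 == y j0)%:R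
           = row_perm (tperm i j) (\matrix_(i0, j0) (x i0 == y j0)%:R) :> 'M[int]_k)%R.
  by apply/matrixP => a b; rewrite !mxE ffunE.
by rewrite row_permE det_mulmx det_perm odd_tperm ij expr1 mulN1r.
Qed.

Lemma alternantE y x :
  alternant y x = (\sum_(s : 'S_k) (-1) ^+ s * [forall i, x i == y (s i)]%:R)%R.
Proof.
apply: eq_bigr => s _; congr (_ * _)%R.
case: forallP => [h|/forallP]; first by apply: big1 => i _; rewrite mxE h.
by rewrite negb_forall => /existsP[i /negbTE e]; rewrite (bigD1 i) //= mxE e mul0r.
Qed.

Definition decreasing x := forall i j : 'I_k, i < j -> x j < x i.

Lemma increasing_perm s : (forall i j : 'I_k, i < j -> s i < s j) -> s = 1%g.
Proof.
move=> incr.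
have ge (i : 'I_k) : i <= s i.
  have [n] := ubnP (val i); elim: n i => // n IH i; rewrite ltnS => ni.
  case e: (val i) => [|i'] //.
  have i'k : i' < k by have := ltn_ord i; rewrite e; lia.
  have := IH (Ordinal i'k); have := incr (Ordinal i'k) i; rewrite /= e; lia.
have tot : \sum_(i < k) s i = \sum_(i < k) i.
  by rewrite [RHS](reindex_inj (@perm_inj _ s)).
apply/permP => i; rewrite perm1; apply: val_inj => /=.
apply/eqP; rewrite eqn_leq ge andbT leqNgt; apply/negP => lt.
have: \sum_(i < k) i < \sum_(i < k) s i.
  rewrite (bigD1 i) //= [X in _ < X](bigD1 i) //=.
  by rewrite -addSn leq_add // leq_sum.
by rewrite tot ltnn.
Qed.

Lemma alternant_decreasing y x : decreasing x -> decreasing y ->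
  alternant y x = ((x == y)%:R)%R.
Proof.
move=> dx dy; rewrite alternantE (bigD1 1%g) //= big1 => [|s s1]; last first.
  case: forallP => [h|_]; last by rewrite mulr0.
  case/eqP: s1; apply: increasing_perm => i j ij.
  have := dx i j ij; rewrite (eqP (h i)) (eqP (h j)) ltnNge => yy.
  rewrite ltnNge; apply/negP; rewrite leq_eqVlt => /predU1P[/val_inj/perm_inj e|/dy].
    by rewrite e ltnn in ij.
  by move/ltnW; apply/negP.
rewrite odd_perm1 expr0 mul1r addr0; congr (_%:R)%R.
congr nat_of_bool; apply/forallP/eqP => [h|-> i]; last by rewrite perm1.
by apply/ffunP => i; rewrite (eqP (h i)) perm1.
Qed.

End Alternants.

(** A transposition is a shorter one conjugated by an adjacent one. Adjacent transpositions are what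
    the reflection of one level provides, since it changes only two neighbouring contents. *)
Lemma adjacent_tperm_ind k (P : 'S_k -> Prop) :
  P 1%g -> (forall s t, P s -> P t -> P (s * t)%g) ->
  (forall (i j : 'I_k), j = i.+1 :> nat -> P (tperm i j)) -> forall s, P s.
Proof.
move=> P1 PM Padj.
have Plt n (i j : 'I_k) : j = i.+1 + n :> nat -> P (tperm i j).
  elim: n i j => [|n IH] i j e; first by apply: Padj; lia.
  have j'k : i.+1 + n < k by have := ltn_ord j; lia.
  pose j' := Ordinal j'k.
  have ij' : i != j' by apply/eqP => /(congr1 val) /=; lia.
  have ij : i != j by apply/eqP => /(congr1 val) /=; lia.
  have jj' : j' != j by apply/eqP => /(congr1 val) /=; lia.
  have -> : tperm i j = (tperm j' j * tperm i j' * tperm j' j)%g.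
    rewrite -{1}[tperm j' j]tpermV -mulgA -/(conjg _ _) tpermJ tpermL.
    by rewrite tpermD // eq_sym.
  have Pj : P (tperm j' j) by apply: Padj => /=; lia.
  by apply: (PM) => //; apply: (PM) => //; apply: IH.
have Pt (i j : 'I_k) : P (tperm i j).
  case: (ltngtP i j) => [ij|ij|/val_inj->]; last by rewrite tperm1.
    by apply: (Plt (j - i.+1)); lia.
  by rewrite tpermC; apply: (Plt (i - j.+1)); lia.
move=> s; have [ts -> _] := prod_tpermP s.
by elim/big_ind: _ => // -[i j] _; apply: Pt.
Qed.

(** * Signed sums over all patterns with top row [nu] *)

Section SignedSum.
Variables (k K M : nat) (nu : nat -> nat).
Hypothesis nuM : forall u, nu u <= M.
Hypothesis nuK : forall u, K <= u -> nu u = 0.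
Notation GT := (gt_pattern k nu).
Notation H := (level_excess K).
Notation fpat := (fpattern k K M).
Implicit Types (g : fpat) (f : pattern).

Definition isGT g : bool := `[< GT (pat_of g) >].

Definition content g : {ffun 'I_k -> nat} :=
  [ffun i : 'I_k => psum (pat_of g i.+1) K - psum (pat_of g i) K].

Definition ftoggle lv J g : fpat := of_pat k K M (toggle lv J (pat_of g)).

Lemma gt_boxed f : GT f -> (forall i u, k < i -> f i u = 0) -> boxed k K M f.
Proof.
move=> gf f0 i u; case: (leqP i k) => ik; last by rewrite f0.
split; first exact: leq_trans (gt_pattern_le gf u ik) (nuM u).
by rewrite /= -leqNgt => Ku; rewrite (gt_pattern_out nuK gf).
Qed.

Lemma pat_of_ftoggle g i J : i.+1 < k -> GT (pat_of g) ->
  frozen_above (pat_of g) i.+1 J ->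
  pat_of (ftoggle i.+1 J g) = toggle i.+1 J (pat_of g).
Proof.
move=> ik gg fz; rewrite of_patK //; apply: gt_boxed; first exact: toggle_gt.
move=> j u kj; rewrite toggle_other; last by lia.
by have [_ ->] := pat_of_boxed g j u; lia.
Qed.

Lemma ftoggleK g i J : i.+1 < k -> GT (pat_of g) ->
  frozen_above (pat_of g) i.+1 J -> ftoggle i.+1 J (ftoggle i.+1 J g) = g.
Proof.
move=> ik gg fz; rewrite /ftoggle (pat_of_ftoggle ik gg fz) //.
by rewrite (toggleK ik gg fz) pat_ofK.
Qed.

(** The constants [c] and [d] absorb the excess terms. They are both zero when [J] bounds all parts,
    and the two contents are then exchanged; at a failure they are neighbouring entries of
    [mu + rho] up to a common constant, and the entries of the endpoint are exchanged. *)
Lemma content_ftoggle g i J (a b : 'I_k) : a = i :> nat -> b = i.+1 :> nat ->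
  GT (pat_of g) -> frozen_above (pat_of g) i.+1 J -> forall c d : nat,
  (c + 2 * H (pat_of g) i.+1 J = d + H (pat_of g) i J + H (pat_of g) i.+2 J) ->
  [/\ c + content (ftoggle i.+1 J g) a = d + content g b,
      d + content (ftoggle i.+1 J g) b = c + content g a &
      forall j, j != a -> j != b -> content (ftoggle i.+1 J g) j = content g j].
Proof.
move=> ea eb gg fz c d cd.
have ik : i.+1 < k by rewrite -eb.
have gg' : GT (toggle i.+1 J (pat_of g)) by exact: toggle_gt.
have le f j : GT f -> j < k -> psum (f j) K <= psum (f j.+1) K.
  by move=> [_ _ h] jk; apply: leq_psum => u; have := h j u jk; lia.
have := toggle_sum nuK J ik gg.
have := le _ i gg; have := le _ i.+1 gg; have := le _ i gg'; have := le _ i.+1 gg'.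
have oth j : j != i.+1 -> psum (toggle i.+1 J (pat_of g) j) K = psum (pat_of g j) K.
  by move=> ji; apply: eq_psum => u _; rewrite toggle_other.
rewrite !ffunE !pat_of_ftoggle // ea eb !(oth i) ?(oth i.+2) //; try lia.
move=> h1 h2 h3 h4 h5; split; try lia.
move=> j ja jb; rewrite !ffunE pat_of_ftoggle // !oth //.
- by apply: contraNneq jb => e; apply/eqP/val_inj; rewrite /= e eb.
- by apply: contraNneq ja => -[e]; apply/eqP/val_inj; rewrite /= e ea.
Qed.

Lemma sum_ftoggle (i J : nat) (P : pred fpat) (F : fpat -> int) :
  i.+1 < k ->
  (forall g, P g -> [/\ GT (pat_of g), frozen_above (pat_of g) i.+1 J
                      & P (ftoggle i.+1 J g)]) ->
  (\sum_(g | P g) F g = \sum_(g | P g) F (ftoggle i.+1 J g))%R.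
Proof.
move=> ik hP.
have inv g : P g -> ftoggle i.+1 J (ftoggle i.+1 J g) = g.
  by move=> Pg; have [gg fz _] := hP g Pg; apply: ftoggleK.
rewrite (reindex_onto (ftoggle i.+1 J) (ftoggle i.+1 J)) //=.
apply: eq_bigl => g; apply/andP/idP => [[Pg /eqP <-]|Pg].
  by have [_ _] := hP _ Pg.
by have [_ _ ->] := hP _ Pg; rewrite inv.
Qed.

(** At [J = M] no part is cut off, so [toggle] is the full Bender-Knuth involution; this is the
    symmetry of Kostka numbers. *)
Lemma content_symmetric (s : 'S_k) (F : {ffun 'I_k -> nat} -> int) :
  (\sum_(g | isGT g) F (content g) = \sum_(g | isGT g) F (permute s (content g)))%R.
Proof.
elim/adjacent_tperm_ind: s F => [|s t IHs IHt|a b eb] F.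
- apply: eq_bigr => g _; congr F; apply/ffunP => i; by rewrite [RHS]ffunE perm1.
- rewrite (IHs F) (IHt (fun x => F (permute s x))).
  apply: eq_bigr => g _; congr F; apply/ffunP => i.
  by rewrite ![permute _ _ _]ffunE permM.
have ik : a.+1 < k by rewrite -eb.
have fz g : isGT g -> frozen_above (pat_of g) a.+1 M.
  move=> /asboolP gg u; have := gt_pattern_le gg u (ltnW ik).
  by have := nuM u; lia.
rewrite (@sum_ftoggle a M) //; last first.
  move=> g Pg; have gg := asboolP _ Pg; split=> //; first exact: fz.
  by apply/asboolP; rewrite pat_of_ftoggle //; [apply: toggle_gt => //|]; apply: fz.
apply: eq_bigr => g Pg; have gg := asboolP _ Pg; congr F.
have H0 j : j <= k -> H (pat_of g) j M = 0.
  move=> jk; rewrite /level_excess (@psum_stable _ 0) ?psum0 // => u _.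
  by have := gt_pattern_le gg u jk; have := nuM u; lia.
have [] := @content_ftoggle g a M a b erefl eb gg (fz g Pg) 0 0.
  by rewrite !H0; lia.
rewrite !add0n => e1 e2 e3; apply/ffunP => j; rewrite [RHS]ffunE.
by case: tpermP => [->|->|/eqP ja /eqP jb] //; apply: e3.
Qed.

Section Dominance.
Variables mu la : nat -> nat.
Hypothesis mu_anti : forall i, i.+1 < k -> mu i.+1 <= mu i.
Hypothesis la_anti : forall i, i.+1 < k -> la i.+1 <= la i.

Definition rho_shift (x : nat -> nat) : {ffun 'I_k -> nat} :=
  [ffun i : 'I_k => x i + (k - i.+1)].

Definition endpoint g : {ffun 'I_k -> nat} :=
  [ffun i => rho_shift mu i + content g i].

Notation sgn g := (alternant (rho_shift la) (endpoint g)).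

(** Largest [J] first, then least [i]. The reflection at this place changes no excess above [J] or a
    larger column, hence no failure that the definition inspects, so the reflected pattern has the
    same first failure and the pairing is an involution. *)
Definition first_failure f (x : 'I_M.+1 * 'I_k) : Prop :=
  [/\ x.2.+1 < k, fails K mu f x.2 x.1,
      forall i J, i.+1 < k -> x.1 < J -> ~ fails K mu f i J
    & forall i, i < x.2 -> ~ fails K mu f i x.1].

Lemma first_failure_unique f x y : first_failure f x -> first_failure f y -> x = y.
Proof.
case: x y => J i [J' i'] [/= h1 h2 h3 h4] [/= h1' h2' h3' h4'].
have eJ : J = J'.
  by apply: val_inj => /=; case: (ltngtP J J') => // [/(h3 _ _ h1')|/(h3' _ _ h1)].
subst J'; congr (_, _); apply: val_inj => /=.
by case: (ltngtP i i') => // [/h4'|/h4].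
Qed.

Lemma no_failure_above f i J : GT f -> i.+1 < k -> M <= J -> ~ fails K mu f i J.
Proof.
move=> gf ik MJ; rewrite /fails.
have H0 j : j <= k -> H f j J = 0.
  move=> jk; rewrite /level_excess (@psum_stable _ 0) ?psum0 // => u _.
  by have := gt_pattern_le gf u jk; have := nuM u; lia.
by rewrite !H0; have := mu_anti ik; lia.
Qed.

Lemma first_failure_exists f : GT f ->
  (exists i J, i.+1 < k /\ fails K mu f i J) -> exists x, first_failure f x.
Proof.
move=> gf ex.
pose P J := `[< exists i, i.+1 < k /\ fails K mu f i J >].
have PM J : P J -> J <= M.
  move=> /asboolP[i [ik fl]]; rewrite leqNgt; apply/negP => MJ.
  exact: (no_failure_above gf ik (ltnW MJ) fl).
have exP : exists J, P J by have [i [J fl]] := ex; exists J; apply/asboolP; exists i.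
case: (ex_maxnP exP PM) => J PJ Jmax.
pose Q i := `[< i.+1 < k /\ fails K mu f i J >].
have exQ : exists i, Q i by move/asboolP: PJ => [i h]; exists i; apply/asboolP.
case: (ex_minnP exQ) => i /asboolP[ik fl] imin.
have JM := PM _ PJ; have ik' := ltnW ik.
exists (Ordinal (JM : J < M.+1), Ordinal ik'); split=> //= [i' J' ik2 JJ fl'|i' ii fl'].
  by have := Jmax J'; rewrite leqNgt JJ => /(_ _)/negP; apply; [apply/asboolP; exists i'|].
have := imin i'; rewrite leqNgt ii => /(_ _)/negP; apply; last by [].
by apply/asboolP; split=> //; lia.
Qed.

Lemma sum_first_failure x :
  (\sum_(g | isGT g && `[< first_failure (pat_of g) x >]) sgn g = 0)%R.
Proof.
case: x => J i; case: (ltnP i.+1 k) => ik; last first.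
  by rewrite big1 // => g /andP[_ /asboolP[/=]]; lia.
pose P g := isGT g && `[< first_failure (pat_of g) (J, i) >].
have drop g : P g -> GT (pat_of g) /\ (mu i + 2 * H (pat_of g) i.+1 J + 1
     = mu i.+1 + H (pat_of g) i J + H (pat_of g) i.+2 J /\ frozen_above (pat_of g) i.+1 J).
  move=> /andP[/asboolP gg /asboolP[/= _ fl hJ _]]; split=> //.
  by apply: (fails_drop nuK gg ik _ fl); apply: hJ.
have hP g : P g -> [/\ GT (pat_of g), frozen_above (pat_of g) i.+1 J
                      & P (ftoggle i.+1 J g)].
  move=> Pg; have [gg [eg fz]] := drop g Pg; split=> //.
  move: Pg => /andP[_ /asboolP[/= _ fl hJ hi]].
  apply/andP; split; apply/asboolP; rewrite pat_of_ftoggle //; first exact: toggle_gt.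
  have fE i' J' : J <= J' -> fails K mu (toggle i.+1 J (pat_of g)) i' J'
                             = fails K mu (pat_of g) i' J'.
    by move=> JJ; rewrite /fails !(toggle_excess K ik gg fz).
  split=> //= [|i' J' ik' JJ|i' ii]; first by rewrite fE.
    by rewrite fE ?(ltnW JJ) //; apply: hJ.
  by rewrite fE //; apply: hi.
suff: (\sum_(g | P g) sgn g = - \sum_(g | P g) sgn g)%R by rewrite /P; lia.
rewrite {1}(sum_ftoggle _ ik hP) -sumrN; apply: eq_bigr => g Pg.
have [gg [eg fz]] := drop g Pg.
have ab : i != Ordinal ik by apply/eqP => /(congr1 val) /=; lia.
rewrite -(alternant_tperm _ _ ab); congr alternant.
(* The successor on [mu i] is the difference of consecutive entries of rho; it makes up for the
   deficit of exactly one found by [fails_drop]. *)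
have [] := @content_ftoggle g i J i (Ordinal ik) erefl erefl gg fz (mu i).+1 (mu i.+1).
  by lia.
move=> e1 e2 e3; apply/ffunP => j; rewrite [RHS]ffunE !ffunE.
case: tpermP => [->|->|/eqP ja /eqP jb].
- by have := ltn_ord i; move: e1; rewrite !ffunE /=; lia.
- by have := ltn_ord i; move: e2; rewrite !ffunE /=; lia.
by have := e3 j ja jb; rewrite !ffunE => ->.
Qed.

Definition dominant g : bool :=
  `[< forall i, i.+1 < k -> column_bound mu (pat_of g) i >].

Lemma sum_dominant :
  (\sum_(g | isGT g) sgn g = \sum_(g | isGT g && dominant g) sgn g)%R.
Proof.
rewrite (bigID dominant) /= -[RHS]addr0; congr (_ + _)%R.
pose p g := [pick x | `[< first_failure (pat_of g) x >]].
rewrite (partition_big p predT) //= big1 // => -[x _|_]; last first.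
  rewrite big1 // => g /andP[/andP[/asboolP gg nd]].
  rewrite /p; case: pickP => // nof _; case/negP: nd; apply/asboolP => i ik.
  apply/(column_boundP nuK gg ik (mu_anti ik)) => J fl.
  have [|x hx] := first_failure_exists gg; first by exists i, J.
  by have := nof x; rewrite asboolT.
rewrite -[RHS](sum_first_failure x); apply: eq_bigl => g.
apply/andP/andP => [[/andP[gg nd]]|[gg /asboolP fx]].
  by rewrite /p; case: pickP => // y fy /eqP[<-].
rewrite gg; split=> /=.
  apply/negP => /asboolP dm; have [/= ik fl _ _] := fx.
  have := dm _ ik; move/(column_boundP nuK (asboolP _ gg) ik (mu_anti ik)).
  by move/(_ x.1).
rewrite /p; case: pickP => [y /asboolP fy|/(_ x)]; last by rewrite asboolT.
by rewrite (first_failure_unique fx fy).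
Qed.

(** On a dominant pattern the bound at [v = K] makes [mu] plus the content weakly decreasing, so the
    endpoint is strictly decreasing and the alternant merely tests whether [mu] plus the content is
    [la]. *)
Lemma nb_lr_patterns_signed :
  ((nb_patterns k K M (lr_pattern k K mu la nu))%:R = \sum_(g | isGT g) sgn g :> int)%R.
Proof.
rewrite sum_dominant /nb_patterns -sum1_card natr_sum big_mkcond [RHS]big_mkcond /=.
apply: eq_bigr => g _; rewrite inE.
case: (boolP (isGT g && dominant g)) => [/andP[/asboolP gg /asboolP dm]|ngd]; last first.
  case: ifP => // /asboolP[gg _ dm]; case/negP: ngd.
  by apply/andP; split; apply/asboolP.
have le j : j < k -> psum (pat_of g j) K <= psum (pat_of g j.+1) K.
  by move=> jk; have [_ _ h] := gg; apply: leq_psum => u; have := h j u jk; lia.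
have decr (x : {ffun 'I_k -> nat}) :
    (forall i j : 'I_k, j = i.+1 :> nat -> x j < x i) -> decreasing x.
  move=> hx i j ij; have [n] := ubnP (j - i); elim: n j ij => // n IH j ij nji.
  have j1k : j.-1 < k by have := ltn_ord j; lia.
  pose j1 := Ordinal j1k; case: (ltnP i j1) => ij1.
    have := IH j1 ij1; have := hx j1 j; rewrite /=; lia.
  by apply: hx; move: ij1; rewrite /=; lia.
rewrite alternant_decreasing; last first.
- by apply: decr => i j e; rewrite !ffunE e; have := ltn_ord j; have := la_anti (i := i); lia.
- apply: decr => i j e; rewrite !ffunE e.
  have jk : i.+1 < k by rewrite -e.
  have := dm i jk K; have := le i; have := le i.+1; rewrite !psumS.
  rewrite !(gt_pattern_out nuK gg) //; try lia.
case: asboolP => [[_ hc _]|nlr]; case: eqP => // e.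
  case: e; apply/ffunP => i; rewrite !ffunE; have := hc i (ltn_ord i); have := le i.
  by have := ltn_ord i; lia.
case: nlr; split=> // i ik; have := congr1 (fun x : {ffun 'I_k -> nat} => x (Ordinal ik)) e.
by rewrite !ffunE /=; have := le i ik; lia.
Qed.

End Dominance.
End SignedSum.

(** * Invariance of the signed sum under rotation *)

Section Rotation.
Variables (k K M C : nat) (nu mu la : nat -> nat).
Hypothesis nuM : forall u, nu u <= M.
Hypothesis nuK : forall u, K <= u -> nu u = 0.
Hypothesis mu_anti : forall i, i.+1 < k -> mu i.+1 <= mu i.
Hypothesis la_anti : forall i, i.+1 < k -> la i.+1 <= la i.
Hypothesis muC : forall i, i < k -> mu i <= C.
Hypothesis laC : forall i, i < k -> la i <= C.

Definition rot_part (x : nat -> nat) i := C - x (k - i.+1).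

Lemma rot_anti x : (forall i, i.+1 < k -> x i.+1 <= x i) ->
  forall i, i.+1 < k -> rot_part x i.+1 <= rot_part x i.
Proof.
move=> hx i ik; rewrite /rot_part; have := hx (k - i.+2).
have -> : (k - i.+2).+1 = k - i.+1 by lia.
lia.
Qed.

Definition rev_perm : 'S_k := perm (@rev_ord_inj k).

Lemma nb_lr_patterns_rot :
  nb_patterns k K M (lr_pattern k K mu la nu)
  = nb_patterns k K M (lr_pattern k K (rot_part la) (rot_part mu) nu).
Proof.
suff: ((nb_patterns k K M (lr_pattern k K mu la nu))%:R
  = (nb_patterns k K M (lr_pattern k K (rot_part la) (rot_part mu) nu))%:R :> int)%R.
  by lia.
have e1 := nb_lr_patterns_signed nuM nuK mu_anti la_anti.
have e2 := nb_lr_patterns_signed nuM nuK (rot_anti la_anti) (rot_anti mu_anti).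
rewrite {}e1 {}e2.
under eq_bigr do rewrite alternantE.
under [RHS]eq_bigr do rewrite alternantE.
rewrite exchange_big [RHS]exchange_big /=.
pose r := rev_perm.
(* Rotation exchanges the roles of [mu] and [la], which inverts the permutation, and reverses the
   indices, which brings in [r] on both sides; the sign is unchanged. *)
rewrite (reindex_inj (h := fun s : 'S_k => (r * s^-1 * r)%g)) /=; last first.
  by move=> s t /mulIg/mulgI/invg_inj.
apply: eq_bigr => s _.
have -> : odd_perm (r * s^-1 * r)%g = s by rewrite !odd_permM odd_permV addbC addbA addbb.
rewrite -!big_distrr /=; congr (_ * _)%R.
pose F (w : {ffun 'I_k -> nat}) : int :=
  ([forall i, rho_shift k mu i + w i == rho_shift k la ((r * s^-1 * r)%g i)]%:R)%R.
transitivity (\sum_(g : fpattern k K M | isGT nu g) F (content g))%R.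
  by apply: eq_bigr => g _; rewrite /F; congr (_%:R)%R; congr nat_of_bool; apply: eq_forallb => i; rewrite ffunE.
(* Permuting the content by [r * s^-1] makes the condition at index [r (s i)] involve entry [i] of
   the content, as in the rotated condition at [i]. *)
rewrite (content_symmetric nuM nuK (r * s^-1)%g F); apply: eq_bigr => g _.
rewrite /F; congr (_%:R)%R; congr nat_of_bool.
have rr i : r (r i) = i by rewrite !permE rev_ordK.
have key i : (rho_shift k mu (r (s i)) + content g i == rho_shift k la (r i))
    = (rho_shift k (rot_part la) i + content g i == rho_shift k (rot_part mu) (s i)).
  have h1 := muC (ltn_ord (r (s i))); have h2 := laC (ltn_ord (r i)).
  move: h1 h2; rewrite !ffunE /rot_part !permE /=.
  by have := ltn_ord i; have := ltn_ord (s i); lia.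
apply/forallP/forallP => h i.
  by rewrite [endpoint _ _ _]ffunE -key; have := h (r (s i)); rewrite [permute _ _ _]ffunE !permM rr permK.
have := h (s^-1 (r i))%g; rewrite [endpoint _ _ _]ffunE -key permKV rr.
by rewrite [permute _ _ _]ffunE !permM.
Qed.

End Rotation.

(** * Diagrams whose rows are intervals *)

Lemma geq_bigminnP (I : finType) (P : pred I) (F : I -> nat) x y :
  reflect (y <= x /\ forall i, P i -> y <= F i) (y <= \big[minn/x]_(i | P i) F i).
Proof.
have H r : (y <= \big[minn/x]_(i <- r | P i) F i)
           = (y <= x) && all (fun i => P i ==> (y <= F i)) r.
  elim: r => [|i r IH]; first by rewrite big_nil andbT.
  by rewrite big_cons /=; case: (P i) => //=; rewrite leq_min IH andbCA.
rewrite H; apply: (iffP andP) => -[h1 h2]; split=> //.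
  by move=> i; apply/implyP; apply: (allP h2); rewrite mem_index_enum.
by apply/allP => i _; apply/implyP/h2.
Qed.

Section Rows.
Variables k m : nat.
Implicit Types (l s : nat -> nat) (b : box k m).

(** Rows are numbered from 0 here, so row [q] is row [q.+1] of the algorithm, while columns still
    start at 1. The value of [l] at an empty row is immaterial. *)
Definition interval_diagram l s : diagram k m :=
  [set b : box k m | l b.1 <= col b < l b.1 + s b.1].

Definition rows_fit l s : Prop :=
  forall q, q < k -> 0 < s q -> 0 < l q /\ l q + s q <= m.+1.

Lemma box_at q j : q < k -> 0 < j <= m -> exists b : box k m, row b = q.+1 /\ col b = j.
Proof.
move=> qk /andP[j0 jm]; have j1 : j.-1 < m by lia.
by exists (Ordinal qk, Ordinal j1); split=> //=; rewrite /col /=; lia.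
Qed.

Section Fixed.
Variables l s : nat -> nat.
Hypothesis fit : rows_fit l s.
Notation D := (interval_diagram l s).

Lemma row_eq b q : (row b == q.+1) = (val b.1 == q).
Proof. by []. Qed.

Lemma has_box_diagram q j : q < k -> 0 < j <= m ->
  has_box D q.+1 j = (l q <= j < l q + s q).
Proof.
move=> qk jm; apply/existsP/idP => [[b]|h].
  by rewrite inE row_eq => /and3P[h /eqP e1 /eqP e2]; rewrite -e1 -e2.
have [b [rb cb]] := box_at qk jm; exists b; rewrite inE rb cb !eqxx.
by move: rb => [->]; rewrite h.
Qed.

Lemma row_empty_diagram q : q < k -> row_empty D q.+1 = (s q == 0).
Proof.
move=> qk; apply/forallP/eqP => [h|s0 b]; last first.
  apply/implyP; rewrite inE row_eq => h; apply/eqP => e; move: h.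
  by rewrite e s0; lia.
apply/eqP; rewrite -leqn0 leqNgt; apply/negP => s0; have [l0 ls] := fit qk s0.
have [|b [rb cb]] := @box_at q (l q) qk; first by lia.
have := h b; rewrite inE rb cb eqxx /=; move: rb => [->]; lia.
Qed.

Lemma lft_diagram q : q < k -> lft D q.+1 = if 0 < s q then l q else m.+1.
Proof.
move=> qk; apply/eqP; rewrite eqn_leq; apply/andP; split; last first.
  apply/geq_bigminnP; split; first by case: ifP => // s0; have := fit qk s0; lia.
  move=> b; rewrite inE row_eq => /andP[h /eqP e]; move: h; rewrite e.
  by case: ifP; lia.
have /geq_bigminnP[h1 h2] := leqnn (lft D q.+1).
case: ifP => // s0; have [l0 ls] := fit qk s0.
have [|b [rb cb]] := @box_at q (l q) qk; first by lia.
have := h2 b; rewrite inE rb cb eqxx andbT; apply.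
by move: rb => [->]; lia.
Qed.

Lemma rgt_diagram q : q < k -> rgt D q.+1 = if 0 < s q then (l q + s q).-1 else 0.
Proof.
move=> qk; apply/eqP; rewrite eqn_leq; apply/andP; split.
  apply/bigmax_leqP => b; rewrite inE row_eq => /andP[h /eqP e]; move: h; rewrite e.
  by case: ifP; lia.
case: ifP => // s0; have [l0 ls] := fit qk s0.
have [|b [rb cb]] := @box_at q (l q + s q).-1 qk; first by lia.
rewrite -cb; apply: (@leq_bigmax_cond _ _ (@col k m)).
by rewrite inE rb cb eqxx andbT; move: rb => [->]; lia.
Qed.

Lemma descent_diagram q : q.+1 < k ->
  descent D q.+2 = (0 < s q.+1) && ((s q == 0) || (l q.+1 < l q)).
Proof.
move=> qk; rewrite /descent /= !lft_diagram //; last exact: ltnW.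
rewrite qk /=; have := fit qk; have := fit (ltnW qk).
by case: (posnP (s q)) => [->|]; case: (posnP (s q.+1)) => [->|]; lia.
Qed.

Lemma pivot_diagram q : q.+1 < k -> descent D q.+2 ->
  (forall q', q < q' -> q'.+1 < k -> ~~ descent D q'.+2) ->
  pivot D = q.+2 /\ ~~ finished D.
Proof.
move=> qk dq nd; split; last first.
  by apply/forallP => /(_ (Ordinal (qk : q.+2 < k.+1))); rewrite dq.
apply/eqP; rewrite eqn_leq; apply/andP; split; last first.
  exact: (@leq_bigmax_cond _ _ (fun i : 'I_k.+1 => val i) (Ordinal (qk : q.+2 < k.+1))).
apply/bigmax_leqP => -[[|[|i]] ik] //= di; rewrite leqNgt; apply/negP => qi.
by have /negP := nd i qi ik; apply.
Qed.

End Fixed.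

Definition setrow (x : nat -> nat) q v : nat -> nat := fun i => if i == q then v else x i.

(** The last hypothesis, the condition allowing Step A, says that the lower row covers all exchanged
    columns; hence both rows stay intervals and the truncated subtractions are exact. *)
Lemma stepA_diagram l s q : rows_fit l s -> q.+1 < k -> 0 < s q -> 0 < s q.+1 ->
  l q.+1 < l q -> l q <= l q.+1 + s q.+1 ->
  stepA (interval_diagram l s) q.+2
  = interval_diagram (setrow (setrow l q (l q.+1)) q.+1 (l q))
      (setrow (setrow s q (s q + (l q - l q.+1))) q.+1 (s q.+1 - (l q - l q.+1))).
Proof.
move=> fit qk sq sq1 lt le; apply/setP => b; rewrite !inE /= !lft_diagram // ?sq ?sq1; last exact: ltnW.
have cb : 0 < col b <= m by rewrite /col /= ltn_ord.
rewrite !has_box_diagram // ?row_eq; last exact: ltnW.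
rewrite /setrow.
case: (eqVneq (val b.1) q.+1) => [->|n1].
  by case: ifP; lia.
case: (eqVneq (val b.1) q) => [->|n2]; last by rewrite if_same.
by case: ifP; lia.
Qed.

(** An empty row has left end [m.+1], so the exchanged columns include the whole lower row. *)
Lemma stepA_diagram_empty l s q : rows_fit l s -> q.+1 < k -> s q = 0 -> 0 < s q.+1 ->
  stepA (interval_diagram l s) q.+2
  = interval_diagram (setrow l q (l q.+1)) (setrow (setrow s q (s q.+1)) q.+1 0).
Proof.
move=> fit qk sq sq1; apply/setP => b; rewrite !inE /= !lft_diagram // ?sq ?sq1 ?ltnn; last exact: ltnW.
have cb : 0 < col b <= m by rewrite /col /= ltn_ord.
have := fit _ qk sq1.
rewrite !has_box_diagram // ?row_eq; last exact: ltnW.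
rewrite /setrow.
case: (eqVneq (val b.1) q.+1) => [->|n1].
  by rewrite sq (gtn_eqF (ltnSn q)); case: ifP; lia.
case: (eqVneq (val b.1) q) => [->|n2]; last by rewrite if_same.
by rewrite ?(ltn_eqF (ltnSn q)) ?eqxx sq; case: ifP; lia.
Qed.

Definition shift_block l s q : nat -> nat := fun x =>
  if [&& q <= x, 0 < s x & l x == l q] then (l x).+1 else l x.

Lemma stepB_diagram l s q : rows_fit l s -> q < k -> 0 < s q ->
  stepB (interval_diagram l s) q.+1 = interval_diagram (shift_block l s q) s.
Proof.
move=> fit qk sq; apply/setP => -[bi bj]; rewrite !inE /row /col /=.
rewrite !lft_diagram // !rgt_diagram // sq /shift_block ltnS.
have [l0 ls] := fit _ qk sq; have := fit bi (ltn_ord _).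
case: (posnP (s bi)) => [->|sb].
  by move=> _ /=; rewrite andbF; have := ltn_ord bj; case: ifP => h; lia.
by move=> /(_ isT)[l0' ls']; case: ifP => h; lia.
Qed.

Lemma card_row_diagram l s (q : 'I_k) : rows_fit l s ->
  #|[set b in interval_diagram l s | row b == q.+1]| = s q.
Proof.
move=> fit; case: (posnP (s q)) => sq.
  rewrite sq; apply/eqP; rewrite cards_eq0; apply/eqP/setP => b; rewrite !inE row_eq.
  by apply/negbTE/negP => /andP[h /eqP e]; move: h; rewrite e sq; lia.
have [l0 ls] := fit q (ltn_ord q) sq.
have jm (j : 'I_(s q)) : (l q).-1 + j < m by have := ltn_ord j; lia.
rewrite -[RHS]card_ord -(card_imset (f := fun j : 'I_(s q) => (q, Ordinal (jm j)) : box k m) predT).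
  apply: eq_card => b; rewrite !inE row_eq; apply/andP/imsetP => [[h /eqP e]|[j _ ->]] /=.
    have jb : (col b) - l q < s q by move: h; rewrite e; lia.
    exists (Ordinal jb) => //; case: b e h jb => /= bi bj e; rewrite /col /= => h jb.
    by congr (_, _); apply: val_inj => //=; move: h; rewrite e; lia.
  by rewrite /col /=; have := ltn_ord j; lia.
by move=> i j [] /addnI/val_inj.
Qed.

Lemma has_ne_shape_diagram l s nu : rows_fit l s ->
  reflect (size nu <= k /\ forall q, q < k -> s q = nth 0 nu q)
    (has_ne_shape (shift_right (interval_diagram l s)) nu).
Proof.
move=> fit.
have sm q : q < k -> s q <= m.
  by move=> qk; case: (posnP (s q)) => [->//|/(fit q qk)]; lia.
apply: (iffP andP) => -[].
  move=> /andP[sz /allP nm] /eqP e; split=> // q qk.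
  have nqm : nth 0 nu q <= m.
    case: (ltnP q (size nu)) => qs; last by rewrite nth_default.
    by apply: nm; apply: mem_nth.
  have key j : 0 < j <= m -> (m < j + s q) = (m < j + nth 0 nu q).
    move=> jm; have [b [rb cb]] := box_at qk jm.
    move/setP/(_ b): e; rewrite !inE.
    have eq : row b = (Ordinal qk).+1 by [].
    by rewrite eq card_row_diagram //= cb /part /=.
  have sq := sm q qk.
  case: (ltngtP (s q) (nth 0 nu q)) => // h.
    by have := key (m.+1 - nth 0 nu q); lia.
  by have := key (m.+1 - s q); lia.
move=> sz h; split.
  rewrite /in_rectangle sz; apply/(all_nthP 0) => i isz.
  by rewrite -h ?sm //; apply: leq_trans isz sz.
apply/eqP/setP => b; rewrite !inE.
have eq : row b = (b.1).+1 by [].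
by rewrite eq card_row_diagram // h // /part.
Qed.

End Rows.

(** * Algorithm 1 *)

Definition step_of_bool (b : bool) : step := if b then StepA else StepB.
Definition bool_of_step (c : step) : bool := if c is StepA then true else false.
Lemma bool_of_stepK : cancel bool_of_step step_of_bool.
Proof. by case. Qed.
HB.instance Definition _ := Countable.copy step (can_type bool_of_stepK).

(** * Counting sequences of choices *)

Section Ways.
Variables (k m : nat) (nu : seq nat).
Implicit Type D : diagram k m.

(** Sequences of choices form an infinite type; an explicit list proves finiteness of the set of
    ways along with its size, and lists for the two branches concatenate. *)
Definition ways_enumerated D n : Prop :=
  exists ws : seq (seq step),
    [/\ uniq ws, size ws = n & forall s, is_way nu D s = (s \in ws)].

Lemma ways_enumerated_card D n :
  ways_enumerated D n -> (ways nu D #= `I_n)%classic%card.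
Proof.
move=> [ws [uws szws hws]].
have -> : ways nu D = [set` [fset x in ws]%fset]%classic.
  by apply/seteqP; split=> s /=; rewrite /ways !inE /= hws.
by apply/card_eq_fsetP; rewrite card_fseq undup_id.
Qed.

Lemma ways_finished D : finished D ->
  ways_enumerated D (has_ne_shape (shift_right D) nu).
Proof.
move=> fD; exists (if has_ne_shape (shift_right D) nu then [:: [::]] else [::]).
split; try by case: ifP.
by case=> [|c s] /=; rewrite fD //=; case: ifP.
Qed.

Definition ways_after c D n : Prop :=
  if allowed c D (pivot D) then ways_enumerated (do_step c D (pivot D)) n
  else n = 0.

Lemma ways_unfinished D nA nB : ~~ finished D ->
  ways_after StepA D nA -> ways_after StepB D nB -> ways_enumerated D (nA + nB).
Proof.
move=> fD.
have H c n : ways_after c D n -> exists ws : seq (seq step),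
    [/\ uniq ws, size ws = n
      & forall s, allowed c D (pivot D) && is_way nu (do_step c D (pivot D)) s = (s \in ws)].
  rewrite /ways_after; case: ifP => [al [ws [h1 h2 h3]]|al ->]; first by exists ws; split.
  by exists [::].
move=> /H[wA [uA sA hA]] /H[wB [uB sB hB]].
exists ([seq StepA :: s | s <- wA] ++ [seq StepB :: s | s <- wB]).
have injc c : injective (cons c : seq step -> seq step) by move=> s t [].
split; last 1 first.
- case=> [|c s] /=; rewrite (negbTE fD) mem_cat /=.
    by apply/esym/negbTE; rewrite negb_or; apply/andP; split; apply/mapP => -[].
  case: c; rewrite mem_map // ?hA ?hB.
    by case: (boolP (_ :: _ \in [seq StepB :: _ | _ <- _])) => [/mapP[]//|_]; rewrite orbF.
  by case: (boolP (_ :: _ \in [seq StepA :: _ | _ <- _])) => [/mapP[]|_].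
- rewrite cat_uniq !map_inj_uniq // uA uB andbT /=.
  by apply/hasPn => s /mapP[t _ ->]; apply/mapP => -[].
by rewrite size_cat !size_map sA sB.
Qed.

End Ways.

Lemma gt_pattern_low k nu f i u : gt_pattern k nu f -> i <= k -> i <= u -> f i u = 0.
Proof.
move=> [h0 _ h]; elim: i u => [|i IH] u ik iu; first by rewrite h0.
case: u iu => // u iu; have := h i u ik; have := IH u; lia.
Qed.

(* The quantity y_u = psum (f t.+1) u.+1 - psum (f t) u - N decreases from
   f t.+1 0 - N to 0 and never exceeds f t u. *)
Section Excess.
Variables (k K t N : nat) (nu : nat -> nat) (f : pattern).
Hypothesis nuK : forall u, K <= u -> nu u = 0.
Hypotheses (gtf : gt_pattern k nu f) (tk : t < k).
Hypothesis size_f : psum (f t.+1) K = psum (f t) K + N.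

Lemma excess_anti u u' : u <= u' ->
  psum (f t.+1) u'.+1 + psum (f t) u <= psum (f t.+1) u.+1 + psum (f t) u'.
Proof using gtf tk.
move=> /subnK<-; elim: (u' - u) => [|d IH] //; have [_ _ h] := gtf.
by rewrite !addSn psumS (psumS (f t)); have := h t (d + u) tk; clear -IH; lia.
Qed.

Lemma excess_large u : K <= u -> psum (f t.+1) u.+1 = psum (f t) u + N.
Proof.
move=> Ku; have z i v : i <= k -> K <= v -> f i v = 0 by exact: (gt_pattern_out nuK gtf).
rewrite (@psum_stable (f t.+1) K) ?(@psum_stable (f t) K) //.
- by move=> v; apply: z; lia.
- by move=> v; apply: z; lia.
- by lia.
Qed.

Lemma excess_ge0 u : psum (f t) u + N <= psum (f t.+1) u.+1.
Proof.
have := excess_large (leq_maxl K u); have := excess_anti (leq_maxr K u); lia.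
Qed.

Lemma excess_le u : psum (f t.+1) u.+1 <= psum (f t) u.+1 + N.
Proof.
have [_ _ h] := gtf.
have anti u' : u <= u' ->
    psum (f t) u'.+1 + psum (f t.+1) u.+1 <= psum (f t) u.+1 + psum (f t.+1) u'.+1.
  move=> /subnK<-; elim: (u' - u) => [|d IH] //.
  by rewrite !addSn psumS (psumS (f t.+1) (_ .+1)); have := h t (d + u).+1 tk; lia.
have := anti _ (leq_maxr K u); have := excess_large (leq_maxl K u).
by rewrite (psumS (f t) (maxn _ _)); lia.
Qed.

End Excess.

Lemma eq_nb_patterns k K M (P Q : pattern -> Prop) :
  (forall f, boxed k K M f -> P f <-> Q f) -> nb_patterns k K M P = nb_patterns k K M Q.
Proof.
move=> h; apply: eq_card => g; rewrite !inE; apply/asboolP/asboolP;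
  by move/(h _ (pat_of_boxed g)).
Qed.

Lemma nb_patterns_split k K M (P Q R : pattern -> Prop) :
  (forall f, P f <-> Q f \/ R f) -> (forall f, Q f -> R f -> False) ->
  nb_patterns k K M P = nb_patterns k K M Q + nb_patterns k K M R.
Proof.
move=> hP dQR; rewrite /nb_patterns -cardsUI.
rewrite [X in _ + X](_ : _ = 0) ?addn0.
  apply: eq_card => g; rewrite !inE.
  by apply/asboolP/orP; rewrite hP => -[/asboolP|/asboolP]; [left|right|left|right].
apply/eqP; rewrite cards_eq0; apply/eqP/setP => g; rewrite !inE.
by apply/negbTE/negP => /andP[/asboolP q /asboolP]; apply: dQR.
Qed.

Lemma nb_patterns0 k K M (P : pattern -> Prop) : (forall f, ~ P f) -> nb_patterns k K M P = 0.
Proof.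
move=> h; apply/eqP; rewrite cards_eq0; apply/eqP/setP => g; rewrite !inE.
by apply/negbTE/negP => /asboolP/h.
Qed.

(** * Sorting one row into the rows below it *)

Section Insertion.
Variables (k m K M : nat) (nus : seq nat) (mu la : nat -> nat).
Notation nu := (nth 0 nus).
Hypothesis nuM : forall u, nu u <= M.
Hypothesis nuK : forall u, K <= u -> nu u = 0.
Hypothesis nu_pos : all (fun x => 0 < x) nus.
Hypothesis kK : k <= K.
Hypothesis mu_anti : forall i j, i <= j -> mu j <= mu i.
Hypothesis la_anti : forall i j, i <= j -> la j <= la i.
Hypothesis mula : forall i, mu i <= la i.
Hypothesis lam : forall i, la i <= m.

Notation muR := (rot_part k m la).
Notation laR := (rot_part k m mu).
Notation N p := (la p - mu p).
Notation a p := (mu p).+1.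
Notation p0 t := (k - t.+1).

(** This is what [column_bound] at [t.-1] leaves to require once it is read on the left ends of the
    rows carrying level [t]; [compatible_completion] makes the translation. *)
Definition left_bound t v (l s : nat -> nat) (f : pattern) : Prop :=
  forall u, v <= u -> p0 t + u.+1 < k -> 0 < s (p0 t + u.+1) ->
    psum (f t.+1) u.+1 + l (p0 t + u.+1) <= psum (f t) u + N (p0 t) + a (p0 t).

(* Levels up to [t] and the first [v] entries of level [t.+1] of [f] are already
   decided by the run of the algorithm; they agree with those of [rho]. *)
Definition compatible t v (rho : pattern) l s (f : pattern) : Prop :=
  [/\ gt_pattern k nu f, has_content k K muR laR f,
      forall i, t <= i -> i.+1 < k -> column_bound muR f i,
      (forall i u, i <= t -> f i u = rho i u)
      /\ (forall u, u < v -> f t.+1 u = rho t.+1 u)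
    & t < k -> left_bound t v l s f].

Notation count t v rho l s := (nb_patterns k K M (compatible t v rho l s)).

Definition content_upto t (rho : pattern) : Prop :=
  forall i, i < t -> psum (rho i.+1) K = psum (rho i) K + N (p0 i).

(* Rows are numbered from 0.  In [stage t] the last [t] rows have been sorted;
   in [mid t v] the row [p0 t] is being inserted below and currently occupies
   the row [p0 t + v]: the rows above it carry the decided entries of level
   [t.+1], the rows below it those of level [t] that it has not met yet. *)
Record stage t (rho : pattern) (l s : nat -> nat) : Prop := Stage {
  st_fit : rows_fit k m l s;
  st_top : forall q, q < k - t -> l q = a q /\ s q = N q;
  st_len : forall u, k - t + u < k -> s (k - t + u) = rho t u;
  st_gt : gt_pattern t (rho t) rho;
  st_content : content_upto t rho;
  st_bound : forall j q, j < k - t -> k - t <= q < k -> 0 < s q ->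
    l q <= a j /\ l q + s q <= (la j).+1;
  st_nested : forall q q', k - t <= q -> q < q' < k -> 0 < s q' ->
    [/\ 0 < s q, l q <= l q' & l q' + s q' <= l q + s q] }.

Record mid t v (rho : pattern) (l s : nat -> nat) : Prop := Mid {
  mi_fit : rows_fit k m l s;
  mi_top : forall q, q < p0 t -> l q = a q /\ s q = N q;
  mi_done : forall u, u < v -> s (p0 t + u) = rho t.+1 u;
  mi_todo : forall u, v <= u -> p0 t + u.+1 < k -> s (p0 t + u.+1) = rho t u;
  mi_cur : s (p0 t + v) + psum (rho t.+1) v = psum (rho t) v + N (p0 t);
  mi_left : 0 < s (p0 t + v) -> l (p0 t + v) = a (p0 t);
  mi_bound : forall q, p0 t <= q < k -> 0 < s q ->
    l q <= a (p0 t) /\ l q + s q <= (la (p0 t)).+1;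
  mi_right : forall q q', p0 t <= q -> q < q' < k -> 0 < s q -> 0 < s q' ->
    l q' + s q' <= l q + s q;
  mi_sorted : forall q q', p0 t <= q -> q < q' < k -> q != p0 t + v ->
    q' != p0 t + v -> 0 < s q' -> 0 < s q /\ l q <= l q';
  mi_full : forall q, p0 t <= q < p0 t + v -> 0 < s (p0 t + v) -> 0 < s q;
  mi_short : s (p0 t + v) = 0 -> forall q, p0 t + v < q < k -> 0 < s q ->
    l q + s q <= a (p0 t);
  mi_link : forall u, u < v -> 0 < s (p0 t + u) ->
    exists2 y, psum (rho t.+1) u.+1 = psum (rho t) u + N (p0 t) + y
    & l (p0 t + u) + y = a (p0 t)
      \/ l (p0 t + u) + s (p0 t + u) <= a (p0 t) /\ s (p0 t + u) <= y;
  mi_gt : gt_pattern t (rho t) rho;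
  mi_content : content_upto t rho;
  mi_inter : forall u, u < v -> rho t u <= rho t.+1 u
    /\ (u.+1 < v -> rho t.+1 u.+1 <= rho t u);
  mi_next : 0 < v -> s (p0 t + v) <= rho t v.-1;
  mi_v : v <= t }.

Lemma stage_mid t rho l s : t < k -> stage t rho l s -> mid t 0 rho l s.
Proof.
move=> tk [fit top len gtr ct bd nest].
have pe : k - t = (p0 t).+1 by lia.
have [lp sp] := top (p0 t) ltac:(lia).
split=> //.
- by move=> q qp; apply: top; lia.
- by move=> u _ uk; rewrite -len ?pe ?addnS // -addnS.
- by rewrite addn0 sp !psum0; lia.
- by rewrite addn0 lp.
- move=> q /andP[pq qk] sq; case: (eqVneq q (p0 t)) => [->|qp].
    by rewrite lp sp; have := mula (p0 t); lia.
  by apply: bd => //; lia.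
- move=> q q' pq qq' sq sq'; case: (eqVneq q (p0 t)) => [e|qp].
    by rewrite e lp sp; have := mula (p0 t); have [] := bd (p0 t) q' _ _ sq'; lia.
  by have [] := nest q q' _ qq' sq' => //; lia.
- move=> q q' pq qq' qb q'b sq'; have [] := nest q q' _ qq' sq' => //; lia.
- by move=> q; lia.
- rewrite addn0 sp => e q qk sq; have := mula (p0 t).
  by have [] := bd (p0 t) q _ _ sq; lia.
Qed.

Lemma rot_content f i : has_content k K muR laR f -> i < k ->
  psum (f i.+1) K = psum (f i) K + N (p0 i).
Proof.
move=> hc ik; have := hc i ik; rewrite /rot_part.
by have := mula (p0 i); have := lam (p0 i); lia.
Qed.

(** Once the inserted row is used up, the excess at [v] is the whole entry [f t.+1 v]. Then
    [excess_le] bounds the entry by [f t v], interlacing gives the converse, and the entry is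
    forced, just as Step A is the only step allowed. *)
Lemma compatible_empty t v rho l s : t < k -> mid t v rho l s ->
  let b := p0 t + v in b.+1 < k -> s b = 0 -> 0 < s b.+1 ->
  forall f, compatible t v rho l s f
    <-> compatible t v.+1 (fun i => if i == t.+1 then setrow (rho i) v (s b.+1) else rho i)
          (setrow l b (l b.+1)) (setrow (setrow s b (s b.+1)) b.+1 0) f.
Proof.
move=> tk M0 b bk sb sb1 f; have eb : p0 t + v = b by [].
clearbody b; set rho' := fun i => _.
have rt i : i <= t -> rho' i = rho i by move=> it; rewrite /rho'; case: eqP => //; lia.
have dE : s b.+1 = rho t v by rewrite -(mi_todo M0) ?addnS ?eb.
have cE := mi_cur M0; rewrite eb sb in cE.
have sh : l b.+1 + s b.+1 <= a (p0 t) by apply: (mi_short M0); rewrite ?eb //; lia.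
have rE u : v < u -> setrow l b (l b.+1) (p0 t + u.+1) = l (p0 t + u.+1)
    /\ (p0 t + u.+1 < k -> setrow (setrow s b (s b.+1)) b.+1 0 (p0 t + u.+1) = s (p0 t + u.+1)).
  by move=> vu; rewrite /setrow; do !case: eqP => //; lia.
split=> -[gf cf colf [ag1 ag2] lf]; split=> //.
- split=> [i u it|u]; first by rewrite rt // ag1.
  rewrite /rho' eqxx /setrow ltnS leq_eqVlt => /predU1P[->|uv]; last first.
    by rewrite (ltn_eqF uv) ag2.
  rewrite eqxx; have sz := rot_content cf tk.
  have := excess_le nuK gf tk sz v; rewrite !psumS.
  rewrite (eq_psum (g := rho t.+1) (v := v)) // (eq_psum (f := f t) (g := rho t) (v := v)); last by move=> *; apply: ag1.
  by have [_ _ h] := gf; have := h t v tk; rewrite !(ag1 t) //; lia.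
- move=> _ u vu uk; have [-> ->] := rE u vu => //; apply: lf => //; lia.
- split=> [i u it|u uv]; first by rewrite -(rt i) // ag1.
  by rewrite ag2 ?(leqW uv) // /rho' eqxx /setrow (ltn_eqF uv).
move=> _ u; rewrite leq_eqVlt => /predU1P[<-|vu] uk su; last first.
  by have [e1 e2] := rE u vu; rewrite -e1 -e2 // in su *; apply: lf.
rewrite psumS (ag2 v) // /rho' eqxx /setrow eqxx.
rewrite (eq_psum (g := rho t.+1) (v := v)); last first.
  by move=> w wv; rewrite ag2 ?(leqW wv) // /rho' eqxx /setrow (ltn_eqF wv).
rewrite (eq_psum (f := f t) (g := rho t) (v := v)); last by move=> *; rewrite ag1 // rt.
rewrite addnS eb; lia.
Qed.

Lemma mid_empty t v rho l s : t < k -> mid t v rho l s ->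
  let b := p0 t + v in b.+1 < k -> s b = 0 -> 0 < s b.+1 ->
  mid t v.+1 (fun i => if i == t.+1 then setrow (rho i) v (s b.+1) else rho i)
          (setrow l b (l b.+1)) (setrow (setrow s b (s b.+1)) b.+1 0).
Proof.
move=> tk M0 b bk sb sb1; have eb : p0 t + v = b by [].
clearbody b; set rho' := fun i => _.
have rt i : i <= t -> rho' i = rho i by move=> it; rewrite /rho'; case: eqP => //; lia.
have r1 : rho' t.+1 = setrow (rho t.+1) v (s b.+1) by rewrite /rho' eqxx.
have rv : psum (rho' t.+1) v = psum (rho t.+1) v.
  by apply: eq_psum => u uv; rewrite r1 /setrow (ltn_eqF uv).
have dE : s b.+1 = rho t v by rewrite -(mi_todo M0) ?addnS ?eb.
have cE := mi_cur M0; rewrite eb sb in cE.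
have sh : l b.+1 + s b.+1 <= a (p0 t) by apply: (mi_short M0); rewrite ?eb //; lia.
have bd1 := mi_bound M0 (q := b.+1).
have gtr' : gt_pattern t (rho' t) rho'.
  have [h0 _ h] := mi_gt M0; split=> // i u it.
  by rewrite !rt ?(ltnW it) //; apply: h.
case: M0 => fit top dn td cur lf bd rg st fu sho lk gtr ct it nx vt.
split=> //.
- move=> q qk; rewrite /setrow; case: (q =P b.+1) => // _; case: eqP => [_|_]; last exact: fit.
  by move=> _; apply: fit.
- by move=> q qp; rewrite /setrow !ifN_eq; [apply: top|..]; lia.
- move=> u uv; rewrite r1 /setrow; do !case: eqP => //; try lia.
  by move=> *; apply: dn; lia.
- move=> u vu uk; rewrite (rt t) // -td //; last by lia.
  by rewrite /setrow !ifN_eq //; lia.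
- rewrite (rt t) // !psumS rv r1 addnS eb /setrow !eqxx; lia.
- by rewrite addnS eb /setrow eqxx.
- move=> q qk; rewrite /setrow; case: (q =P b.+1) => // _; case: (q =P b) => [_|_] sq; last exact: bd.
  by apply: bd1; lia.
- move=> q q' pq qq'; rewrite /setrow; case: (q =P b.+1) => // _; case: (q' =P b.+1) => // qb1.
  case: (q =P b) => [e|_]; case: (q' =P b) => [e'|_] sq sq'; try lia.
  + by apply: rg => //; lia.
  + by apply: rg => //; lia.
  + exact: rg.
- move=> q q' pq qq'; rewrite addnS eb /setrow => n1 n2; rewrite (negbTE n1) (negbTE n2).
  case: (q =P b) => [e|qb]; case: (q' =P b) => [e'|q'b] sq'; try lia.
  + by have [] := st b.+1 q' _ _ _ _ sq'; lia.
  + by have [] := st q b.+1 _ _ _ _ sb1; lia.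
  + by apply: st => //; rewrite eb; apply/eqP.
- by rewrite addnS eb /setrow eqxx.
- move=> _ q; rewrite addnS eb /setrow => qk; rewrite !ifN_eq; try lia.
  by move=> sq; apply: sho => //; rewrite eb; lia.
- move=> u; rewrite ltnS leq_eqVlt => /predU1P[->|uv].
    rewrite (rt t) // psumS rv r1 /setrow eb !eqxx (ltn_eqF (ltnSn b)) => _.
    (* The row moved up ends left of column [a (p0 t)] and its excess is its whole length: this is
       the second alternative of [mi_link]. *)
    by exists (s b.+1); [lia|right; lia].
  rewrite /setrow !ifN_eq; try lia.
  move=> su; have [y e1 e2] := lk u uv su; exists y => //; rewrite (rt t) // -e1.
  by apply: eq_psum => w wu; rewrite r1 /setrow ifN_eq //; lia.
- by move=> i ik; rewrite !rt ?(ltnW ik) //; apply: ct.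
- move=> u uv; rewrite (rt t) // r1 /setrow.
  have an := gt_pattern_anti u gtr (leqnn t).
  move: uv; rewrite ltnS leq_eqVlt => /predU1P[->|uv].
    by rewrite eqxx dE leqnn; split=> //; lia.
  rewrite (ltn_eqF uv); have [h1 h2] := it u uv; split=> // _.
  by case: eqP => [e|ne]; [rewrite dE -e|apply: h2; lia].
- by rewrite addnS eb /setrow eqxx.
have := gt_pattern_low gtr (leqnn t) (u := v).
by rewrite -dE ltnNge => h; apply/negP => /h; lia.
Qed.

Lemma compatible_prefix t v rho l s f : compatible t v rho l s f ->
  psum (f t.+1) v = psum (rho t.+1) v /\ forall u, psum (f t) u = psum (rho t) u.
Proof.
move=> [_ _ _ [ag1 ag2] _]; split=> [|u]; apply: eq_psum => w wu; first exact: ag2.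
exact: ag1.
Qed.

(** * The inserted row meets a row starting further left *)

Section Meeting.
Variables (t v b : nat) (rho : pattern) (l s : nat -> nat).
Hypotheses (tk : t < k) (M0 : mid t v rho l s) (eb : p0 t + v = b).
Hypotheses (bk : b.+1 < k) (sb : 0 < s b) (sb1 : 0 < s b.+1).
Hypothesis lt_l : l b.+1 < a (p0 t).
Let c := l b.+1.
Let y := a (p0 t) - c.

(** By [mi_cur], [s b] is the value of entry [v] with excess zero; Step A gives it the largest
    excess that [left_bound] permits. *)
Definition rhoA : pattern := fun i =>
  if i == t.+1 then setrow (rho i) v (s b + y) else rho i.

Lemma rhoA_low i : i <= t -> rhoA i = rho i.
Proof. by move=> it; rewrite /rhoA; case: eqP => //; lia. Qed.

Lemma rhoA_psum u : u <= v -> psum (rhoA t.+1) u = psum (rho t.+1) u.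
Proof. by move=> uv; apply: eq_psum => w wu; rewrite /rhoA eqxx /setrow ifN_eq //; lia. Qed.

Lemma meeting_left : l b = a (p0 t).
Proof. by have := mi_left M0; rewrite eb => ->. Qed.

Lemma meeting_todo : s b.+1 = rho t v.
Proof. by rewrite -(mi_todo M0) ?addnS ?eb. Qed.

Lemma meeting_right : c + s b.+1 <= a (p0 t) + s b.
Proof. by rewrite -meeting_left; apply: (mi_right M0) => //; lia. Qed.

Notation lA := (setrow (setrow l b c) b.+1 (l b)).
Notation sA := (setrow (setrow s b (s b + y)) b.+1 (s b.+1 - y)).
Notation lB := (shift_block l s b.+1).

Lemma compatibleA f :
  compatible t v.+1 rhoA lA sA f
  <-> compatible t v rho l s f /\ psum (f t.+1) v.+1 + c = psum (f t) v + N (p0 t) + a (p0 t).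
Proof.
have cE := mi_cur M0; rewrite eb in cE.
have rE u : v < u -> lA (p0 t + u.+1) = l (p0 t + u.+1) /\ sA (p0 t + u.+1) = s (p0 t + u.+1).
  by move=> vu; rewrite /setrow !ifN_eq //; lia.
split=> [cf|[cf e]]; have [pf1 pf2] := compatible_prefix cf;
    case: (cf) => gf cof colf [ag1 ag2] lf.
  have e : psum (f t.+1) v.+1 + c = psum (f t) v + N (p0 t) + a (p0 t).
    by rewrite pf1 pf2 psumS rhoA_psum // (rhoA_low (leqnn t)) // /rhoA eqxx /setrow eqxx /y; lia.
  split=> //; split=> //.
    split=> [i u it|u uv]; first by rewrite -(rhoA_low it) ag1.
    by rewrite ag2 ?(leqW uv) // /rhoA eqxx /setrow (ltn_eqF uv).
  move=> _ u; rewrite leq_eqVlt => /predU1P[<-|vu] uk su.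
    by rewrite addnS eb -/c e.
  by have [e1 e2] := rE u vu; rewrite -e1 -e2 in su *; apply: lf.
split=> //.
  split=> [i u it|u]; first by rewrite (rhoA_low it) ag1.
  rewrite /rhoA eqxx /setrow ltnS leq_eqVlt => /predU1P[->|uv].
    by rewrite eqxx; move: e; rewrite psumS pf1 pf2 /y; lia.
  by rewrite (ltn_eqF uv) ag2.
move=> _ u vu uk; have [-> ->] := rE u vu => su; apply: lf => //; exact: ltnW.
Qed.

Lemma midA : y <= s b.+1 -> mid t v.+1 rhoA lA sA.
Proof.
move=> yd; have lb := meeting_left; have dE := meeting_todo; have mr := meeting_right.
have bd0 := mi_bound M0 (q := b); have bd1 := mi_bound M0 (q := b.+1).
have r1 : rhoA t.+1 = setrow (rho t.+1) v (s b + y) by rewrite /rhoA eqxx.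
have gtr' : gt_pattern t (rhoA t) rhoA.
  have [h0 _ h] := mi_gt M0; split=> // i u it.
  by rewrite !rhoA_low ?(ltnW it) //; apply: h.
(* Interlacing of the new entry with entry [v.-1] of level [t], which by [mi_cur] equals [s b] plus
   the excess at [v.-1]. The row above starts no further right than row [b.+1], so its excess is at
   least [y]; the other alternative of [mi_link] would make it end left of row [b], against
   [mi_right]. *)
have y_prev : 0 < v -> s b + y <= rho t v.-1.
  case: (v) M0 eb => // w Mw ew _.
  have sw : 0 < s (p0 t + w) by apply: (mi_full Mw); rewrite ?ew //; lia.
  have [z e1 [e2|[e2 _]]] := mi_link Mw (ltnSn w) sw.
    have := mi_cur Mw; rewrite ew !psumS in e1 *.
    have [] := mi_sorted Mw (q := p0 t + w) (q' := b.+1); try lia.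
    by rewrite /y /c /=; lia.
  by have := mi_right Mw (q := p0 t + w) (q' := b); rewrite /=; lia.
case: M0 => fit top dn td cur lf bd rg st fu sho lk gtr ct it nx vt.
rewrite eb in cur lf st fu sho nx.
split=> //.
- move=> q qk; rewrite /setrow; case: (q =P b.+1) => [_|_]; last case: (q =P b) => [_|_].
  + by rewrite lb; have := bd1; have := fit b.+1; rewrite /y /c; lia.
  + by have := fit b.+1; have := fit b; rewrite lb /y /c; lia.
  exact: fit.
- by move=> q qp; rewrite /setrow !ifN_eq; [apply: top|..]; lia.
- move=> u uv; rewrite r1 /setrow.
  case: (u =P v) => [->|uv']; first by rewrite eb eqxx ifN_eq //; lia.
  by rewrite !ifN_eq ?dn //; lia.
- move=> u vu uk; rewrite (rhoA_low (leqnn t)) // -td //; last by lia.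
  by rewrite /setrow !ifN_eq //; lia.
- by rewrite (rhoA_low (leqnn t)) // !psumS rhoA_psum // r1 addnS eb /setrow !eqxx; lia.
- by rewrite addnS eb /setrow eqxx lb.
- move=> q qk; rewrite /setrow; case: (q =P b.+1) => [_|_]; last case: (q =P b) => [_|_].
  + by have := bd1; rewrite lb /y /c; lia.
  + by have := bd0; have := bd1; rewrite lb /y /c; lia.
  exact: bd.
- move=> q q' pq qq'.
  (* Step A exchanges only initial segments, so the right ends of both rows stay put. *)
  have end_b : c + (s b + y) = l b + s b by rewrite lb /y; lia.
  have end_b1 : l b + (s b.+1 - y) = c + s b.+1 by rewrite lb /y; lia.
  have old : 0 < s q -> 0 < s q' -> l q' + s q' <= l q + s q by exact: rg.
  rewrite /setrow.
  case: (q =P b.+1) => [e|n1]; case: (q' =P b.+1) => [e'|n2]; try lia.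
  + case: (q' =P b) => [e''|n3]; first by lia.
    by have := old; rewrite e end_b1 -/c => o _ sq'; apply: o.
  + case: (q =P b) => [e''|n3]; first by rewrite end_b end_b1 lb => _ _; lia.
    by have := old; rewrite e' end_b1 -/c => o sq _; apply: o.
  case: (q =P b) => [e|n3]; case: (q' =P b) => [e'|n4]; try lia.
  + by have := old; rewrite e end_b => o _ sq'; apply: o.
  by have := old; rewrite e' end_b => o sq _; apply: o.
- move=> q q' pq qq'; rewrite addnS eb /setrow => n1 n2; rewrite (negbTE n1) (negbTE n2).
  case: (q =P b) => [e|qb]; case: (q' =P b) => [e'|q'b] sq'; try lia.
  + by have [] := st b.+1 q' _ _ _ _ sq'; rewrite /c; lia.
  + by have [] := st q b.+1 _ _ _ _ sb1; rewrite /c; lia.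
  by apply: st => //; apply/eqP.
- move=> q; rewrite addnS eb /setrow eqxx => qk _; rewrite ifN_eq; last by lia.
  by case: eqP => [_|qb]; [lia|apply: fu => //; lia].
- rewrite addnS eb /setrow eqxx => e q qk; rewrite !ifN_eq; try lia.
  move=> sq; have := rg b.+1 q _ _ sb1 sq; rewrite -/c /y in e yd *; lia.
- move=> u; rewrite ltnS leq_eqVlt => /predU1P[->|uv].
    rewrite (rhoA_low (leqnn t)) // psumS rhoA_psum // r1 /setrow eb eqxx ifN_eq; last by lia.
    by rewrite eqxx ifN_eq; [exists y; [lia|left; rewrite /y; lia]|lia].
  rewrite /setrow !ifN_eq; try lia.
  by move=> su; have [z e1 e2] := lk u uv su; exists z => //; rewrite (rhoA_low (leqnn t)) // -e1 rhoA_psum.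
- by move=> i ik; rewrite !rhoA_low ?(ltnW ik) //; apply: ct.
- move=> u; rewrite (rhoA_low (leqnn t)) // r1 /setrow ltnS leq_eqVlt => /predU1P[->|uv].
    by rewrite eqxx -dE; split; [rewrite /y /c in mr *; lia|lia].
  rewrite (ltn_eqF uv); have [h1 h2] := it u uv; split=> // _.
  case: eqP => [e|ne]; last by apply: h2; lia.
  by have := y_prev; rewrite -e /=; apply; lia.
- by rewrite addnS eb /setrow eqxx (rhoA_low (leqnn t)) //= -dE; lia.
have := gt_pattern_low gtr (leqnn t) (u := v).
by rewrite -dE ltnNge => h; apply/negP => /h; lia.
Qed.

(** Step B moves every lower row starting in column [c], which tightens several bounds at once.
    Strictness at [v] alone implies all of them, since the excess decreases with [u]. *)
Lemma compatibleB f :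
  compatible t v rho lB s f
  <-> compatible t v rho l s f /\ psum (f t.+1) v.+1 + c < psum (f t) v + N (p0 t) + a (p0 t).
Proof.
have lBE q : b < q -> 0 < s q -> lB q = if l q == c then (l q).+1 else l q.
  by move=> bq sq; rewrite /shift_block bq sq.
split=> [[gf cf colf ag lf]|[[gf cf colf ag lf] lt]].
  split; last first.
    have := lf tk v (leqnn v); rewrite addnS eb lBE // eqxx => /(_ bk sb1).
    by rewrite -/c; lia.
  split=> // _ u vu uk su; have := lf tk u vu uk su; rewrite lBE //; last by lia.
  by case: ifP; lia.
split=> // _ u vu uk su; rewrite lBE //; last by lia.
have := lf tk u vu uk su; case: eqP => // -> _.
have := excess_anti gf tk vu; lia.
Qed.

Lemma midB : c + s b.+1 < a (p0 t) + s b -> mid t v rho lB s.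
Proof.
move=> room; have lb := meeting_left.
have lBE q : lB q = if [&& b < q, 0 < s q & l q == c] then (l q).+1 else l q by [].
have lBo q : q <= b -> lB q = l q by move=> qb; rewrite lBE ltnNge qb.
case: M0 => fit top dn td cur lf bd rg st fu sho lk gtr ct it nx vt.
(* The lower rows are nested in row [b.+1], so the one column that [room] leaves up to the end of
   row [b] serves the whole shifted block. *)
have blk q : b < q < k -> 0 < s q -> c <= l q /\ l q + s q <= c + s b.+1.
  move=> bq sq; case: (eqVneq q b.+1) => [->|qb]; first by rewrite -/c.
  have [] := st b.+1 q _ _ _ _ sq; try lia.
  by have := rg b.+1 q; rewrite -/c; lia.
split=> //.
- move=> q qk sq; have [l0 ls] := fit q qk sq.
  have [_] := fit b (ltnW bk) sb; rewrite lb lBE => lsb.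
  by case: ifP => // h; have := blk q; lia.
- by move=> q qp; rewrite lBo; [apply: top|lia].
- by rewrite eb lBo // lb.
- move=> q qk sq; have [b1 b2] := bd q qk sq; have [|_] := bd b _ sb; first by lia.
  by rewrite lb lBE; case: ifP => // h; have := blk q; lia.
- move=> q q' pq qq' sq sq'; have := rg q q' pq qq' sq sq'.
  rewrite !lBE; case: ifP => h; case: ifP => h' // e; try lia.
  have bq' := blk q' _ sq'.
  case: (ltnP b q) => bq.
    have [] := st q q' pq qq' _ _ sq'; try lia.
    by have := blk q; lia.
  have : l b + s b <= l q + s q.
    by case: (eqVneq q b) => [->//|qb]; apply: rg => //; lia.
  by rewrite lb; lia.
- move=> q q' pq qq' n1 n2 sq'; have [h1 h2] := st q q' pq qq' n1 n2 sq'; split=> //.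
  by rewrite !lBE; have := blk q'; case: ifP => h; case: ifP => h'; lia.
- by rewrite eb => s0; lia.
- by move=> u uv su; rewrite lBo; [apply: lk|lia].
Qed.

End Meeting.

(** * The inserted row has found its place *)

Section Completion.
Variables (t v : nat) (rho : pattern) (l s : nat -> nat).
Hypotheses (tk : t < k) (M0 : mid t v rho l s).
Hypothesis rest : forall q, p0 t + v < q < k -> 0 < s q ->
  0 < s (p0 t + v) /\ l q = a (p0 t).

Definition rhoC : pattern := fun i =>
  if i == t.+1 then (fun u => if p0 t + u < k then s (p0 t + u) else 0) else rho i.

Lemma rhoC_low i : i <= t -> rhoC i = rho i.
Proof. by move=> it; rewrite /rhoC; case: eqP => //; lia. Qed.

Lemma rhoCE u : rhoC t.+1 u = if p0 t + u < k then s (p0 t + u) else 0.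
Proof. by rewrite /rhoC eqxx. Qed.

Lemma todoE u : v <= u -> rho t u = if p0 t + u.+1 < k then s (p0 t + u.+1) else 0.
Proof.
move=> vu; case: ifP => uk; first by rewrite (mi_todo M0).
by apply: (gt_pattern_low (mi_gt M0)) => //; lia.
Qed.

Lemma rhoC_psum_done u : u <= v -> psum (rhoC t.+1) u = psum (rho t.+1) u.
Proof.
move=> uv; apply: eq_psum => w wu; rewrite rhoCE -(mi_done M0); last by lia.
by rewrite ifT //; have := mi_v M0; lia.
Qed.

(** No exchange is left to do, so the remaining excesses are zero: entry [v] is what remains of the
    inserted row, and each later entry is the preceding entry of level [t]. *)
Lemma rhoC_psum u : v <= u -> psum (rhoC t.+1) u.+1 = psum (rho t) u + N (p0 t).
Proof.
move=> /subnK<-; elim: (u - v) => [|d IH].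
  rewrite add0n psumS rhoC_psum_done // rhoCE ifT; first by have := mi_cur M0; lia.
  by have := mi_v M0; lia.
rewrite addSn psumS IH psumS rhoCE todoE ?addnS; last by lia.
by lia.
Qed.

(** Either the left end of a row records its excess exactly, or the row lies wholly left of column
    [a (p0 t)] and its excess is at least its length. In the second case the left end need not
    record anything, because the next bounds hold by themselves. *)
Lemma completion_link u : p0 t + u < k -> 0 < s (p0 t + u) ->
  exists2 y, psum (rhoC t.+1) u.+1 = psum (rho t) u + N (p0 t) + y
  & l (p0 t + u) + y = a (p0 t)
    \/ l (p0 t + u) + s (p0 t + u) <= a (p0 t) /\ s (p0 t + u) <= y.
Proof.
move=> uk su; case: (ltnP u v) => uv.
  by have [y e1 e2] := mi_link M0 uv su; exists y; rewrite ?rhoC_psum_done.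
exists 0; first by rewrite rhoC_psum ?addn0.
left; rewrite addn0; move: uv; rewrite leq_eqVlt => /predU1P[e|uv].
  by rewrite -e in su *; apply: (mi_left M0).
by have [_ ->] := rest (q := p0 t + u) ltac:(lia) su.
Qed.

Lemma stage_completion : stage t.+1 rhoC l s.
Proof.
have gtr := mi_gt M0; have := mi_v M0 => vt.
have inter u : rho t u <= rhoC t.+1 u /\ rhoC t.+1 u.+1 <= rho t u.
  have an := gt_pattern_anti u gtr (leqnn t).
  case: (ltnP u v) => uv.
    have [h1 h2] := mi_inter M0 uv; have uk : p0 t + u < k by lia.
    rewrite !rhoCE uk (mi_done M0) //; split=> //; case: ifP => // u1k.
    case: (eqVneq u.+1 v) => [e|ne]; first by rewrite e; have := mi_next M0; rewrite -e; apply.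
    by rewrite (mi_done M0); [apply: h2|]; lia.
  rewrite (todoE uv) !rhoCE leqnn; split=> //.
  case: ifP => // u1k; rewrite ifT; last by lia.
  case: (posnP (s (p0 t + u.+1))) => [->//|su1].
  have [sv e1] := rest (q := p0 t + u.+1) ltac:(lia) su1.
  move: uv; rewrite leq_eqVlt => /predU1P[e|uv].
    rewrite -e in u1k su1 e1 *.
    by have := mi_right M0 (q := p0 t + v) (q' := p0 t + v.+1); rewrite e1 (mi_left M0) //; lia.
  have [] := mi_sorted M0 (q := p0 t + u) (q' := p0 t + u.+1) _ _ _ _ su1; try lia.
  move=> su _; have [_ e2] := rest (q := p0 t + u) ltac:(lia) su.
  by have := mi_right M0 (q := p0 t + u) (q' := p0 t + u.+1); rewrite e1 e2; lia.
have [h0 _ h] := gtr.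
split=> //.
- exact: mi_fit M0.
- exact: mi_top M0.
- by move=> u uk; rewrite rhoCE uk.
- split=> // i u; rewrite ltnS leq_eqVlt => /predU1P[->|it]; first by rewrite rhoC_low.
  by rewrite !rhoC_low ?(ltnW it) //; apply: h.
- move=> i; rewrite ltnS leq_eqVlt => /predU1P[->|it]; last first.
    by rewrite !rhoC_low ?(ltnW it) //; apply: (mi_content M0).
  rewrite (rhoC_low (leqnn t)) -(rhoC_psum (u := K)) ?psumS; last by lia.
  by rewrite rhoCE ifN ?addn0 //; lia.
- move=> j q jp qk sq; have [h1 h2] := mi_bound M0 qk sq.
  have := mu_anti (ltnW jp); have := la_anti (ltnW jp); lia.
move=> q q' pq qq' sq'.
case: (eqVneq q (p0 t + v)) => [e|n1].
  have [sv e1] := rest (q := q') ltac:(lia) sq'.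
  rewrite e (mi_left M0) // e1; split=> //.
  by have := mi_right M0 (q := p0 t + v) (q' := q'); rewrite e1 (mi_left M0) //; apply => //; lia.
case: (eqVneq q' (p0 t + v)) => [e|n2].
  have sq : 0 < s q by apply: (mi_full M0); rewrite -?e //; lia.
  have [h1 h2] := mi_bound M0 (q := q) ltac:(lia) sq.
  split=> //; first by rewrite e (mi_left M0) // -e.
  exact: (mi_right M0).
have [sq h1] := mi_sorted M0 pq qq' n1 n2 sq'; split=> //.
exact: (mi_right M0).
Qed.

(** Here [column_bound] at [t] is traded for [left_bound] at [t.+1]. If [l + y = a], the two
    inequalities coincide. Otherwise both are automatic: the next excess is at most the row length
    by [excess_le], hence at most [y], and the row ends before column [a (p0 t)], which is at most
    [a (p0 t.+1)]. *)
Lemma compatible_completion f :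
  compatible t v rho l s f <-> compatible t.+1 0 rhoC l s f.
Proof.
have muS := mu_anti (leq_sub2l k (leqnSn t.+1)).
have lap := lam (p0 t); have lap' := lam (p0 t.+1).
have mlp := mula (p0 t); have mlp' := mula (p0 t.+1).
split=> [cf|cf]; case: (cf) => gf cof colf [ag1 ag2] lf; have szt := rot_content cof tk.
  (* Every nonempty row below starts in column [a (p0 t)], so [left_bound] leaves no room for an
     excess; for an empty row [excess_le] does the same. *)
  have zero u : v <= u -> psum (f t.+1) u.+1 = psum (f t) u + N (p0 t).
    move=> vu; have := excess_ge0 nuK gf tk szt u; have := excess_le nuK gf tk szt u.
    rewrite (psumS (f t)) (ag1 t) // (todoE vu); case: ifP => uk; last by lia.
    case: (posnP (s (p0 t + u.+1))) => [->|su]; first by lia.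
    have := lf tk u vu uk su; have [_ ->] := rest (q := p0 t + u.+1) ltac:(lia) su.
    lia.
  have [pf1 pf2] := compatible_prefix cf.
  have psE w : psum (f t.+1) w = psum (rhoC t.+1) w.
    case: (leqP w v) => wv.
      by rewrite rhoC_psum_done //; apply: eq_psum => x xw; apply: ag2; lia.
    by case: w wv => // w wv; rewrite zero // rhoC_psum // pf2.
  have fE u : f t.+1 u = rhoC t.+1 u by have := psE u.+1; rewrite !psumS psE; lia.
  split=> // [i ti||tk1 u _].
  - by apply: colf; lia.
  - split=> // i u; rewrite leq_eqVlt => /predU1P[->//|it].
    by rewrite rhoC_low // ag1.
  have -> : p0 t.+1 + u.+1 = p0 t + u by lia.
  move=> uk su; have [y e1 e2] := completion_link uk su.
  have := colf t (leqnn t) tk1 u; rewrite /rot_part.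
  have szt1 := rot_content cof tk1; have ex := excess_le nuK gf tk1 szt1 u.
  rewrite (psumS (f t.+1)) fE rhoCE uk in ex.
  rewrite (psE u.+1) e1 pf2.
  by case: e2 => [e2|[e2 e3]]; lia.
have fE u : f t.+1 u = rhoC t.+1 u by rewrite ag1.
have psE w : psum (f t.+1) w = psum (rhoC t.+1) w by apply: eq_psum => x _.
have ptE w : psum (f t) w = psum (rho t) w.
  by apply: eq_psum => x _; rewrite ag1 // rhoC_low.
split=> //.
- move=> i; rewrite leq_eqVlt => /predU1P[<-|]; last exact: colf.
  move=> tk1 u; rewrite /rot_part.
  have szt1 := rot_content cof tk1.
  have := excess_le nuK gf tk1 szt1 u; have := excess_ge0 nuK gf tk szt u.
  rewrite (psumS (f t.+1)) fE rhoCE.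
  case: ifP => uk; last by lia.
  case: (posnP (s (p0 t + u))) => [->|su]; first by lia.
  have [y e1 e2] := completion_link uk su.
  have := lf tk1 u (leq0n u); have -> : p0 t.+1 + u.+1 = p0 t + u by lia.
  move=> /(_ uk su).
  have := psE u.+1; rewrite psumS fE rhoCE uk e1 ptE.
  by case: e2 => [e2|[e2 e3]]; lia.
- split=> [i u it|u uv]; first by rewrite ag1 ?rhoC_low //; lia.
  by rewrite fE rhoCE (mi_done M0) // ifT //; have := mi_v M0; lia.
move=> _ u vu uk su; rewrite psE rhoC_psum // ptE.
by have [] := mi_bound M0 (q := p0 t + u.+1) _ su; lia.
Qed.

End Completion.

Lemma mid_rest t v rho l s : t < k -> mid t v rho l s ->
  ~ ((p0 t + v).+1 < k /\ 0 < s (p0 t + v).+1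
     /\ (s (p0 t + v) = 0 \/ l (p0 t + v).+1 < a (p0 t))) ->
  forall q, p0 t + v < q < k -> 0 < s q -> 0 < s (p0 t + v) /\ l q = a (p0 t).
Proof.
move=> tk M0 nst q qk sq; set b := p0 t + v in nst *.
have [s1 l1] : 0 < s b.+1 /\ l b.+1 <= l q.
  case: (eqVneq q b.+1) => [<-|qb]; first by split.
  by apply: (mi_sorted M0); rewrite -/b //; lia.
have [h1 _] := mi_bound M0 (q := q) ltac:(lia) sq.
have s0 : 0 < s b.
  by rewrite lt0n; apply/eqP => s0; apply: nst; split; [lia|split=> //; left].
split=> //; apply/eqP; rewrite eqn_leq h1 /=.
apply: leq_trans l1; rewrite leqNgt; apply/negP => l1; apply: nst.
by split; [lia|split=> //; right].
Qed.

Notation D l s := (interval_diagram k m l s).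

Lemma mid_pivot t v rho l s : t < k -> mid t v rho l s ->
  let b := p0 t + v in b.+1 < k -> 0 < s b.+1 -> (s b = 0 \/ l b.+1 < l b) ->
  pivot (D l s) = b.+2 /\ ~~ finished (D l s).
Proof.
move=> tk M0 b bk sb1 h; apply: pivot_diagram => //.
  rewrite descent_diagram ?sb1 //; first by lia.
  exact: mi_fit M0.
move=> q bq qk; rewrite descent_diagram //; last exact: mi_fit M0.
apply/negP => /andP[sq1]; have [] := mi_sorted M0 (q := q) (q' := q.+1) _ _ _ _ sq1.
all: rewrite -/b; lia.
Qed.

(** All levels are decided, so the only candidate is [rho] cut off above level [k], and it qualifies
    exactly when the row lengths are the parts of [nu]. *)
Lemma stage_end rho l s : stage k rho l s ->
  ways_enumerated nus (D l s) (count k 0 rho l s).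
Proof.
move=> [fit top len gtr ct bd nest].
have fin : finished (D l s).
  apply/forallP => -[[|[|q]] qk] //=; rewrite descent_diagram //.
  apply/negP => /andP[sq1]; have [] := nest q q.+1 _ _ sq1; lia.
have := @ways_finished k m nus _ fin; congr ways_enumerated.
have lenE q : q < k -> s q = rho k q by move=> qk; rewrite -len ?subnn.
have [h0 _ h] := gtr.
case: (has_ne_shape_diagram nus fit) => hs; last first.
  rewrite nb_patterns0 // => f [gf _ _ [ag _] _]; apply: hs.
  have [_ fk _] := gf.
  have nuE u : nu u = rho k u by rewrite -fk ag.
  split=> [|q qk]; last by rewrite lenE // nuE.
  rewrite leqNgt; apply/negP => ks.
  (* A part of [nu] at index [k] would be positive, whereas level [k] vanishes there. *)
  have := allP nu_pos _ (mem_nth 0 ks); rewrite nuE.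
  by rewrite (gt_pattern_low gtr).
have [sz eqs] := hs.
have nuE u : rho k u = nu u.
  case: (ltnP u k) => uk; first by rewrite -lenE // eqs.
  by rewrite (gt_pattern_low gtr) // nth_default //; apply: leq_trans uk.
pose f0 : pattern := fun i u => if i <= k then rho i u else 0.
have gf0 : gt_pattern k nu f0.
  split=> [u|u|i u ik]; rewrite /f0 ?leqnn // ?h0 // (ltnW ik) ik; exact: h.
have b0 : boxed k K M f0.
  by apply: (gt_boxed nuM nuK gf0) => i u ki; rewrite /f0 leqNgt ki.
transitivity #|[set of_pat k K M f0]|; first by rewrite cards1.
apply: eq_card => g; rewrite !inE.
apply/eqP/asboolP => [->|[gg cg _ [ag _] _]].
  rewrite (of_patK b0); split=> //; last by rewrite ltnn.
  - move=> i ik; rewrite /rot_part.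
    have ii : psum (f0 i.+1) K = psum (f0 i) K + N (p0 i).
      by rewrite /f0 /psum ik (ltnW ik); apply: ct.
    by have := mula (p0 i); have := lam (p0 i); lia.
  - by move=> i ki; lia.
  by split=> // i u ik; rewrite /f0 ik.
rewrite -[g]pat_ofK; congr of_pat; apply: funext => i; apply: funext => u.
rewrite /f0; case: leqP => ik; first exact: ag.
by have [_ ->] := pat_of_boxed g i u; lia.
Qed.

(** Step A raises [v]. Step B keeps [v] and brings the left end of the row below one column closer
    to [a (p0 t)]; hence the nested induction. A step that is not allowed corresponds to an empty
    class of patterns. *)
Lemma mid_count t v rho l s : t < k ->
  (forall rho l s, stage t.+1 rho l s ->
     ways_enumerated nus (D l s) (count t.+1 0 rho l s)) ->
  mid t v rho l s -> ways_enumerated nus (D l s) (count t v rho l s).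
Proof.
move=> tk IHt.
have [n] := ubnP (t - v); elim: n v rho l s => // n IHn v rho l s.
have [d] := ubnP (a (p0 t) - l (p0 t + v).+1); elim: d l => // d IHd l dl tv M0.
pose b := p0 t + v.
have [hst|/(mid_rest tk M0) rest] := pselect (b.+1 < k /\ 0 < s b.+1
     /\ (s b = 0 \/ l b.+1 < a (p0 t))); last first.
  have := IHt _ _ _ (stage_completion tk M0 rest).
  congr ways_enumerated; apply: eq_nb_patterns => f _.
  by rewrite (compatible_completion tk M0 rest).
have [bk [sb1 hsb]] := hst.
have vt : v < t by rewrite /b in bk; lia.
have fit := mi_fit M0.
case: (posnP (s b)) => sb.
  have [pv nf] := mid_pivot tk M0 bk sb1 (or_introl sb).
  rewrite (eq_nb_patterns (Q := compatible t v.+1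
     (fun i => if i == t.+1 then setrow (rho i) v (s b.+1) else rho i)
     (setrow l b (l b.+1)) (setrow (setrow s b (s b.+1)) b.+1 0))); last first.
    by move=> f _; apply: compatible_empty.
  rewrite -[count _ _ _ _ _]addn0; apply: ways_unfinished => //; rewrite /ways_after pv /=.
    rewrite row_empty_diagram ?sb ?orbT; [|exact: fit|lia].
    rewrite stepA_diagram_empty //; apply: IHn; first by lia.
    exact: mid_empty.
  by rewrite !rgt_diagram ?sb //; lia.
have lb : l b = a (p0 t) by apply: (mi_left M0).
have ltl : l b.+1 < a (p0 t) by case: hsb => // e; rewrite e in sb.
have [pv nf] : pivot (D l s) = b.+2 /\ ~~ finished (D l s).
  by apply: (mid_pivot tk M0) => //; right; rewrite -/b lb.
have mr : l b.+1 + s b.+1 <= a (p0 t) + s b.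
  by rewrite -lb; apply: (mi_right M0) => //; rewrite /b; lia.
pose at_meeting f := psum (f t.+1) v.+1 + l b.+1 = psum (f t) v + N (p0 t) + a (p0 t).
pose below_meeting f := psum (f t.+1) v.+1 + l b.+1 < psum (f t) v + N (p0 t) + a (p0 t).
rewrite (@nb_patterns_split k K M _ (fun f => compatible t v rho l s f /\ at_meeting f)
    (fun f => compatible t v rho l s f /\ below_meeting f)); last first.
- by move=> f [_ e1] [_]; rewrite /below_meeting e1 ltnn.
- move=> f; split=> [cf|[[]|[]]] //.
  have [_ _ _ _ lf] := cf; have := lf tk v (leqnn v); rewrite addnS -/b => /(_ bk sb1).
  by rewrite leq_eqVlt => /predU1P[e|e]; [left|right].
have todo : s b.+1 = rho t v by rewrite -(mi_todo M0) ?addnS.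
apply: ways_unfinished => //; rewrite /ways_after pv /=.
  rewrite !lft_diagram ?rgt_diagram ?row_empty_diagram ?sb ?sb1 ?(gtn_eqF sb) ?orbF ?lb //; try lia.
  rewrite prednK; last by lia.
  case: ifP => al.
    pose lA := setrow (setrow l b (l b.+1)) b.+1 (l b).
    pose sA := setrow (setrow s b (s b + (a (p0 t) - l b.+1))) b.+1
                 (s b.+1 - (a (p0 t) - l b.+1)).
    have -> : stepA (D l s) b.+2 = D lA sA by rewrite stepA_diagram /lA /sA ?lb.
    rewrite (eq_nb_patterns (Q := compatible t v.+1 (rhoA t v b rho l s) lA sA)).
      by apply: IHn; [lia|apply: midA => //; lia].
    by move=> f _; symmetry; apply: compatibleA.
  (* Step A is refused when [a (p0 t) - l b.+1] exceeds [s b.+1], the entry [f t v]; an excess that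
     large contradicts [excess_le]. *)
  rewrite nb_patterns0 // => f [cf e].
  have [gf cof _ [ag1 _] _] := cf.
  have := excess_le nuK gf tk (rot_content cof tk) v.
  by move: e; rewrite /at_meeting psumS (psumS (f t)) (ag1 t) // -todo; lia.
rewrite !rgt_diagram ?sb ?sb1 ?lb //; try lia.
case: ifP => al.
  rewrite stepB_diagram //.
  rewrite (eq_nb_patterns (Q := compatible t v rho (shift_block l s b.+1) s)).
    apply: IHd => //.
      by move: dl; rewrite -/b /shift_block leqnn sb1 eqxx /=; lia.
    by apply: midB => //; lia.
  by move=> f _; symmetry; apply: compatibleB.
(* Step B is refused when the right ends agree. A smaller excess would then push [f t.+1 v] below
   [s b.+1], the entry [f t v], against interlacing. *)
rewrite nb_patterns0 // => f [cf e].
have [pf1 pf2] := compatible_prefix cf.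
have [[_ _ h] _ _ [ag1 _] _] := cf.
have := h t v tk; have := mi_cur M0; move: e; rewrite /below_meeting psumS pf1 pf2 (ag1 t) // -todo -/b.
by lia.
Qed.

Lemma stage_count t rho l s : t <= k -> stage t rho l s ->
  ways_enumerated nus (D l s) (count t 0 rho l s).
Proof.
move=> tk; have [n] := ubnP (k - t); elim: n t tk rho l s => // n IHn t tk rho l s kt st.
move: (tk); rewrite leq_eqVlt => /predU1P[e|tk1].
  by rewrite e in st *; apply: stage_end.
apply: mid_count => //; last exact: stage_mid.
by move=> rho' l' s' st'; apply: IHn => //; lia.
Qed.

Lemma ways_lr_patterns :
  ways_enumerated nus (D (fun q => a q) (fun q => N q))
    (nb_patterns k K M (lr_pattern k K muR laR nu)).
Proof.
have st : stage 0 (fun _ _ => 0) (fun q => a q) (fun q => N q).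
  split=> //; try by [move=> *; lia].
  by move=> q qk s0; have := lam q; lia.
have := stage_count (leq0n k) st; congr ways_enumerated; apply: eq_nb_patterns => f _.
split=> [[gf cf colf _ _]|[gf cf colf]]; first by split=> // i ik; apply: colf.
split=> // [i _||k0 u _]; [exact: colf| |lia].
by split=> // i u; rewrite leqn0 => /eqP->; have [->] := gf.
Qed.

End Insertion.

(** * Littlewood-Richardson tableaux *)

Lemma filter_take (T : Type) (P : pred T) s :
  pairwise (fun x y => P y ==> P x) s -> filter P s = take (count P s) s.
Proof.
elim: s => //= x s IH /andP[hx /IH IHs]; case: ifP => Px; first by rewrite /= -IHs.
have nP : all (predC P) s by apply: sub_all hx => y /=; rewrite Px implybF.
rewrite all_predC in nP; move: (nP); rewrite has_count -leqNgt leqn0 => /eqP c0.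
by rewrite IHs c0 take0.
Qed.

Lemma pairwise_allpairs (S T : Type) (r1 e : rel S) (r2 : rel T) s t :
  pairwise r1 s -> pairwise r2 t -> (forall x, e x x) ->
  pairwise (fun x y : S * T => r1 x.1 y.1 || (e x.1 y.1 && r2 x.2 y.2))
    [seq (i, j) | i <- s, j <- t].
Proof.
move=> ps pt ee; elim: s ps => //= x s IH /andP[hx /IH IHs].
rewrite pairwise_cat IHs andbT; apply/andP; split.
  rewrite /allrel all_map; apply/allT => j /=.
  elim: s hx {IH IHs} => //= y s IHs /andP[rxy /IHs]; rewrite all_cat => ->.
  by rewrite andbT all_map; apply/allT => j' /=; rewrite rxy.
rewrite pairwise_map; apply: sub_pairwise pt => a b /= ->.
by rewrite ee orbT.
Qed.

Lemma count_uniq_card (T : finType) (s : seq T) (P : pred T) : uniq s ->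
  count P s = #|[set x in s | P x]|.
Proof.
move=> us; rewrite -size_filter -(card_uniqP _) ?filter_uniq //.
by apply: eq_card => x; rewrite !inE mem_filter andbC.
Qed.

Section Tableaux.
Variables (k m K M : nat) (las mus nus : seq nat).
Notation nu := (nth 0 nus).
Notation mu := (nth 0 mus).
Notation la := (nth 0 las).
Notation n := (size nus).
Hypothesis nuM : forall u, nu u <= M.
Hypothesis nK : n <= K.
Hypothesis mu_anti : forall i j, i <= j -> mu j <= mu i.
Hypothesis la_anti : forall i j, i <= j -> la j <= la i.
Hypothesis mula : forall i, mu i <= la i.
Hypothesis lam : forall i, la i <= m.

Notation D := (skew_diagram k m las mus).
Implicit Types (T : filling k m n) (b : box k m).

Lemma mem_skew b : (b \in D) = (mu b.1 < col b <= la b.1).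
Proof. by rewrite inE. Qed.

Definition tab_pattern T : pattern := fun i u =>
  if i <= k then #|[set b in D | (b.1 < i) && (T b == u.+1 :> nat)]| else 0.

Lemma tab_pattern_above T i u : k < i -> tab_pattern T i u = 0.
Proof. by rewrite /tab_pattern ltnNge => /negbTE->. Qed.

Definition row_count T i v := #|[set b in D | (val b.1 == i) && (T b <= v)]|.

Lemma card_segment i x : i < k -> mu i + x <= m ->
  #|[set b : box k m | (val b.1 == i) && (mu i < col b <= mu i + x)]| = x.
Proof.
move=> ik mx; have fit : rows_fit k m (fun _ => (mu i).+1) (fun _ => x).
  by move=> q _ x0; lia.
rewrite -[RHS](card_row_diagram (Ordinal ik) fit); apply: eq_card => b.
by rewrite !inE row_eq /= andbC addSn ltnS.
Qed.

Definition supported T := forall b, (b \in D) = (0 < T b).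

Lemma psum_tab_pattern T i v : supported T -> i <= k ->
  psum (tab_pattern T i) v = #|[set b in D | (b.1 < i) && (T b <= v)]|.
Proof.
move=> pT ik; elim: v => [|v IH].
  rewrite psum0; apply/esym/eqP; rewrite cards_eq0; apply/eqP/setP => b; rewrite !inE.
  by apply/negbTE; have := pT b; rewrite inE => ->; lia.
rewrite psumS IH /tab_pattern ik -cardsUI [X in _ + X = _](_ : _ = 0).
  rewrite addn0; apply: eq_card => b; rewrite !inE -!andb_orr; congr (_ && (_ && _)); lia.
apply/eqP; rewrite cards_eq0; apply/eqP/setP => b; rewrite !inE.
by apply/negbTE/negP => /andP[/and3P[_ _ h1] /and3P[_ _ h2]]; lia.
Qed.

Lemma psum_tab_patternS T i v : supported T -> i < k ->
  psum (tab_pattern T i.+1) v = psum (tab_pattern T i) v + row_count T i v.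
Proof.
move=> pT ik; rewrite !psum_tab_pattern //; last exact: ltnW.
rewrite /row_count -cardsUI [X in _ = _ + X](_ : _ = 0).
  rewrite addn0; apply: eq_card => b; rewrite !inE -!andb_orr -andb_orl.
  by congr (_ && (_ && _)); rewrite ltnS leq_eqVlt orbC.
apply/eqP; rewrite cards_eq0; apply/eqP/setP => -[bi bj]; rewrite !inE /=.
by apply/negbTE/negP => /andP[/and3P[_ h1 _] /and3P[_ h2 _]]; lia.
Qed.

Definition row_weak T := forall b b', b \in D -> b' \in D -> val b.1 = val b'.1 ->
  col b <= col b' -> T b <= T b'.
Definition col_strict T := forall b b', b \in D -> b' \in D -> col b = col b' ->
  b.1 < b'.1 -> T b < T b'.

Lemma semistandardP T :
  reflect [/\ supported T, row_weak T & col_strict T] (semistandard D T).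
Proof.
apply: (iffP and3P) => -[h1 h2 h3]; split.
- by move=> b; apply/eqP; apply: (forallP h1).
- move=> b b' bD b'D e1 e2.
  have /forallP/(_ b)/implyP/(_ bD)/forallP/(_ b')/implyP/(_ b'D)/implyP := h2; apply.
  by rewrite e2 andbT /row e1.
- move=> b b' bD b'D e1 e2.
  have /forallP/(_ b)/implyP/(_ bD)/forallP/(_ b')/implyP/(_ b'D)/implyP := h3; apply.
  by rewrite e1 eqxx /row ltnS.
- by apply/forallP => b; apply/eqP.
- apply/forallP => b; apply/implyP => bD; apply/forallP => b'; apply/implyP => b'D.
  by apply/implyP => /andP[/eqP[e1] e2]; apply: h2.
apply/forallP => b; apply/implyP => bD; apply/forallP => b'; apply/implyP => b'D.
by apply/implyP => /andP[/eqP e1]; rewrite /row ltnS; apply: h3.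
Qed.

(** In a weakly increasing row the letters at most [v] form an initial segment. Hence the counts
    determine the row, which gives injectivity and the inverse [tab_of]. *)
Lemma row_countP T b v : row_weak T -> b \in D ->
  (T b <= v) = (col b <= mu b.1 + row_count T b.1 v).
Proof.
case: b => bi bj rw bD; have := bD; rewrite mem_skew /= => /andP[cb1 cb2].
have lb := lam bi; have bk := ltn_ord bi; set c := col _ in cb1 cb2 *.
apply/idP/idP => h.
  suff: c - mu bi <= row_count T bi v by lia.
  rewrite -{1}(@card_segment bi (c - mu bi)) ?/row_count //; last by lia.
  apply: subset_leq_card; apply/fintype.subsetP => -[bi' bj']; rewrite !inE /= => /andP[/eqP e h'].
  have b'D : (bi', bj') \in D by rewrite mem_skew /= e; lia.
  move: (b'D); rewrite mem_skew /= e eqxx /part /= e => -> /=.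
  by apply: leq_trans h; apply: rw => //=; rewrite -/c; lia.
rewrite leqNgt; apply/negP => vT.
suff: row_count T bi v <= c.-1 - mu bi by lia.
rewrite -[X in _ <= X](@card_segment bi) ?/row_count //; last by lia.
apply: subset_leq_card; apply/fintype.subsetP => -[bi' bj'].
rewrite inE mem_skew inE /= => /and3P[b'D /eqP e Tv].
rewrite e eqxx /=; rewrite e in b'D; case/andP: (b'D) => -> _ /=.
rewrite leqNgt; apply/negP => cc.
have b'D' : (bi', bj') \in D by rewrite mem_skew /= e.
have cle : c <= col ((bi', bj') : box k m) by rewrite /c /col /= in cb1 cc *; lia.
by have := leq_trans (rw _ _ bD b'D' (esym e) cle) Tv; rewrite leqNgt => /negP; apply.
Qed.

Lemma row_count_full T i : supported T -> i < k -> row_count T i n = la i - mu i.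
Proof.
move=> pT ik; rewrite -(@card_segment i (la i - mu i)) //; last by have := lam i; have := mula i; lia.
apply: eq_card => b; rewrite !inE -[T b <= n]ltnS ltn_ord andbT andbC.
by case: eqP => //= e; rewrite /part /= e subnKC.
Qed.

Lemma row_count_mono T i v w : v <= w -> row_count T i v <= row_count T i w.
Proof.
move=> vw; rewrite /row_count; apply: subset_leq_card; apply/fintype.subsetP => b; rewrite !inE.
by move=> /and3P[-> -> h] /=; apply: leq_trans h vw.
Qed.

Definition boxes_in_order : seq (box k m) :=
  [seq b <- [seq (i, j) | i <- enum 'I_k, j <- rev (enum 'I_m)] | b \in D].

Definition reads_before b b' : bool := (b.1 < b'.1) || ((val b.1 == b'.1) && (b'.2 < b.2)).

Lemma boxes_in_order_pairwise : pairwise reads_before boxes_in_order.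
Proof.
have incr r : pairwise (fun i j : 'I_r => i < j) (enum 'I_r).
  have : pairwise ltn (map val (enum 'I_r)).
    by rewrite val_enum_ord -sorted_pairwise ?iota_ltn_sorted //; apply: ltn_trans.
  by rewrite pairwise_map.
apply: pairwise_filter.
apply: (@pairwise_allpairs _ _ (fun i j : 'I_k => i < j) (fun i j => val i == j)
          (fun i j : 'I_m => j < i)) => //.
rewrite -sorted_pairwise ?rev_sorted; last by move=> x y z /= h1 h2; apply: ltn_trans h2 h1.
by rewrite sorted_pairwise // => x y z; apply: ltn_trans.
Qed.

Lemma mem_boxes_in_order b : (b \in boxes_in_order) = (b \in D).
Proof.
rewrite mem_filter; case: (b \in D) => //=; apply/allpairsP; exists b.
by rewrite mem_rev !mem_enum; case: b.
Qed.

Lemma boxes_in_order_uniq : uniq boxes_in_order.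
Proof.
rewrite filter_uniq // allpairs_uniq ?rev_uniq ?enum_uniq //.
by move=> [x y] [x' y'] _ _ /= [-> ->].
Qed.

Lemma count_boxes_in_order (P : pred (box k m)) :
  count P boxes_in_order = #|[set b in D | P b]|.
Proof.
rewrite count_uniq_card ?boxes_in_order_uniq //.
by apply: eq_card => b; rewrite !inE mem_boxes_in_order inE.
Qed.

(** A prefix ending in row [i] contains all rows above and nothing below, so it has at most
    [tab_pattern T i.+1 u.+1] letters [u.+2] and at least [tab_pattern T i u] letters [u.+1]. One
    prefix for each [i] and [u] attains both extremes. *)
Lemma ballotP T : supported T -> row_weak T ->
  reflect (forall i u, i < k -> tab_pattern T i.+1 u.+1 <= tab_pattern T i u)
    (ballot (reverse_reading_word D T)).
Proof.
move=> pT rw; set L := boxes_in_order.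
have cnt p v : count_mem v (take p (reverse_reading_word D T))
    = count (fun b => T b == v :> nat) (take p L).
  by rewrite /reverse_reading_word -map_take count_map.
apply: (iffP allP) => [hb i u ik|hp p _].
  (* The extremal prefix: since rows are read from their larger letters, it can stop in row [i]
     after the letters [u.+2] and before any letter [u.+1]. *)
  pose P b := (b.1 < i) || ((val b.1 == i) && (u.+1 < T b)).
  have fE : filter P L = take (count P L) L.
    apply: filter_take; apply: (@sub_in_pairwise _ (mem D) _ _ _ _ _ boxes_in_order_pairwise).
      move=> [bi bj] [bi' bj'] bD b'D; rewrite /reads_before /P /= => rb; apply/implyP.
      case/orP=> [h|/andP[/eqP h1 h2]]; first by apply/orP; left; lia.
      case/orP: rb => [h|/andP[/eqP h3 h4]]; first by apply/orP; left; lia.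
      apply/orP; right; rewrite h3 h1 eqxx /=; apply: leq_trans h2 _.
      by apply: rw => //=; rewrite /col /=; lia.
    by apply/allP => b; rewrite mem_boxes_in_order.
  have cP : count P L <= size L by exact: count_size.
  have e1 : count (fun b => T b == u.+2 :> nat) (take (count P L) L) = tab_pattern T i.+1 u.+1.
    rewrite -fE count_filter count_boxes_in_order /tab_pattern ik; apply: eq_card => b.
    rewrite !inE /P /=; congr (_ && _); case: (T b =P u.+2 :> nat) => [->|_]; rewrite ?andbF //.
    by rewrite ltnSn !andbT [RHS]ltnS [RHS]leq_eqVlt orbC.
  have e2 : count (fun b => T b == u.+1 :> nat) (take (count P L) L) = tab_pattern T i u.
    rewrite -fE count_filter count_boxes_in_order /tab_pattern (ltnW ik); apply: eq_card => b.
    rewrite !inE /P /=; congr (_ && _); case: (T b =P u.+1 :> nat) => [->|_]; rewrite ?andbF //.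
    by rewrite ltnn andbF orbF andbT.
  rewrite -e1 -e2 -!cnt.
  case: (boolP (u.+2 \in reverse_reading_word D T)) => uw.
    have := hb (count P L); rewrite mem_iota /= add0n size_map ltnS => /(_ cP).
    by move=> /allP/(_ _ uw) /=.
  by rewrite (count_memPn _) //; apply: contra uw; apply: mem_take.
apply/allP => v _; apply/implyP => v1; rewrite !cnt.
case: p => [|p]; first by rewrite take0.
case: v v1 => [|[|u]] // _.
wlog: p / p < size L => [hw|pL].
  case: (ltnP p (size L)) => pL; first exact: hw.
  rewrite take_oversize ?(leqW pL) //.
  case: (posnP (size L)) => [/size0nil->//|L0].
  by have := hw (size L).-1; rewrite prednK // take_size => /(_ (leqnn _)).
have uL : uniq (take p.+1 L) by apply: take_uniq; apply: boxes_in_order_uniq.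
have L0 : 0 < size L by apply: leq_ltn_trans pL.
case EL: L L0 => [|bb L'] // _; rewrite -EL.
pose b0 := nth bb L p.
have pw := boxes_in_order_pairwise.
have before b : b \in take p.+1 L -> b.1 <= b0.1.
  move=> /(nthP bb)[q]; rewrite size_take; move=> hq; rewrite nth_take; last by move: hq; case: ifP; lia.
  move=> <-; case: (eqVneq q p) => [->//|qp].
  have qp' : q < p by move: hq; case: ifP; lia.
  have qL : q < size L by lia.
  by case/orP: (pairwiseP bb pw q p qL pL qp') => [/ltnW|/andP[/eqP-> _]].
have after b : b \in D -> b.1 < b0.1 -> b \in take p.+1 L.
  rewrite -mem_boxes_in_order -/L => bL bb0.
  have iL : index b L < size L by rewrite index_mem.
  case: (ltnP (index b L) p.+1) => ip.
    by rewrite -(nth_index bb bL) -(nth_take bb ip) mem_nth // size_take; case: ifP => _.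
  have := pairwiseP bb pw p (index b L) pL iL ip; rewrite nth_index //.
  case/orP=> [h|/andP[/eqP h _]]; first by have := ltn_trans h bb0; rewrite ltnn.
  by move: bb0; rewrite -h ltnn.
apply: (@leq_trans (tab_pattern T b0.1.+1 u.+1)).
  rewrite count_uniq_card // /tab_pattern ltn_ord; apply: subset_leq_card.
  apply/fintype.subsetP => b; rewrite inE => /andP[bt Tb]; rewrite inE ltnS before // Tb !andbT.
  by rewrite -mem_boxes_in_order; apply: mem_take bt.
apply: (leq_trans (hp _ _ (ltn_ord b0.1))).
rewrite count_uniq_card // /tab_pattern (ltnW (ltn_ord _)); apply: subset_leq_card.
by apply/fintype.subsetP => b; rewrite inE => /and3P[bD bb0 Tb]; rewrite inE after.
Qed.

Definition lr_tableau T : bool :=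
  [&& semistandard D T, has_weight D T nus & ballot (reverse_reading_word D T)].

Lemma has_weightP T : supported T ->
  reflect (forall u, tab_pattern T k u = nu u) (has_weight D T nus).
Proof.
move=> pT; have E (v : 'I_n.+1) : 0 < v ->
    tab_pattern T k v.-1 = #|[set b in D | T b == v]|.
  move=> v0; rewrite /tab_pattern leqnn; apply: eq_card => b; rewrite !inE ltn_ord /=.
  by rewrite prednK.
apply: (iffP forallP) => [h u|h v].
  case: (ltnP u n) => un; last first.
    rewrite nth_default // /tab_pattern leqnn; apply/eqP; rewrite cards_eq0.
    apply/eqP/setP => b; rewrite !inE; apply/negbTE/negP => /and3P[_ _ /eqP e].
    by have := ltn_ord (T b); rewrite e ltnS ltnNge un.
  have := h (Ordinal (un : u.+1 < n.+1)) => /implyP/(_ isT)/eqP.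
  by rewrite -E.
by apply/implyP => v0; rewrite -E // h /part.
Qed.

Lemma lr_tableau_pattern T : lr_tableau T ->
  lr_pattern k K mu la nu (tab_pattern T) /\ boxed k K M (tab_pattern T).
Proof.
move=> /and3P[/semistandardP[pT rw cs] wT bT].
have {}wT := has_weightP pT wT; have {}bT := ballotP pT rw bT.
have gt : gt_pattern k nu (tab_pattern T).
  split=> // [u|i u ik].
    by apply/eqP; rewrite /tab_pattern leq0n cards_eq0; apply/eqP/setP => b; rewrite !inE ltn0 andbF.
  split; last exact: bT.
  rewrite /tab_pattern ik (ltnW ik); apply: subset_leq_card; apply/fintype.subsetP => b.
  by rewrite !inE => /and3P[-> h ->] /=; rewrite andbT; apply: ltnW.
have out i u : n <= u -> tab_pattern T i u = 0.
  move=> nu; rewrite /tab_pattern; case: ifP => // _; apply/eqP; rewrite cards_eq0.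
  apply/eqP/setP => b; rewrite !inE; apply/negbTE/negP => /and3P[_ _ /eqP e].
  by have := ltn_ord (T b); rewrite e ltnS ltnNge nu.
split; last first.
  move=> i u; split.
    case: (leqP i k) => ik; last by rewrite tab_pattern_above.
    exact: leq_trans (gt_pattern_le gt u ik) (nuM u).
  rewrite negb_and -ltnNge -leqNgt => /orP[h|h]; last by apply: out; apply: leq_trans h.
  exact: tab_pattern_above.
split=> // [i ik|i ik v].
  rewrite !(psum_stable (out _) nK) psum_tab_patternS // row_count_full //.
  by have := mula i; lia.
rewrite !(psum_tab_patternS _ pT) //; try lia.
suff: mu i.+1 + row_count T i.+1 v.+1 <= mu i + row_count T i v by lia.
rewrite leqNgt; apply/negP => lt.
have full : row_count T i.+1 v.+1 <= la i.+1 - mu i.+1.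
  rewrite -(row_count_full pT ik); case: (leqP v.+1 n) => vn; first exact: row_count_mono.
  rewrite /row_count; apply: subset_leq_card; apply/fintype.subsetP => b; rewrite !inE.
  by move=> /and3P[-> -> _] /=; rewrite -ltnS ltn_ord.
have l1 := la_anti (leqnSn i); have l2 := lam i; have l3 := mula i.+1.
have m1 := mu_anti (leqnSn i).
(* The last box of row [i.+1] with a letter at most [v.+1]. If the bound failed, the box above it
   would lie in the diagram and hold a letter exceeding [v], against column strictness. *)
have [|b1 [r1 c1]] := @box_at k m i.+1 (mu i.+1 + row_count T i.+1 v.+1) ik; first by lia.
have [|b0 [r0 c0]] := @box_at k m i (mu i.+1 + row_count T i.+1 v.+1) (ltnW ik); first by lia.
case: r1 => r1; case: r0 => r0.
have D0 : b0 \in D by rewrite mem_skew r0 c0; lia.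
have D1 : b1 \in D by rewrite mem_skew r1 c1; lia.
have T1 : T b1 <= v.+1 by rewrite (row_countP _ rw D1) r1 c1.
have T0 : ~~ (T b0 <= v) by rewrite (row_countP _ rw D0) r0 c0 -ltnNge.
have := cs b0 b1 D0 D1; rewrite c0 c1 r0 r1 => /(_ erefl (ltnSn i)) h.
by move: T0; rewrite -ltnS (leq_trans h T1).
Qed.

Definition row_cum (f : pattern) i v := psum (f i.+1) v - psum (f i) v.

(** The entry is the least [v] whose segment of letters at most [v] reaches the column of the box,
    as dictated by [row_countP]. *)
Definition tab_of (f : pattern) : filling k m n :=
  [ffun b : box k m => inord (if b \in D then
     find (fun v => col b <= mu b.1 + row_cum f b.1 v) (iota 0 n.+1) else 0)].

Section Inverse.
Variable f : pattern.
Hypothesis lrf : lr_pattern k K mu la nu f.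

Lemma pattern_psumS i v : i < k -> psum (f i.+1) v = psum (f i) v + row_cum f i v.
Proof.
move=> ik; have [[_ _ h] _ _] := lrf; rewrite /row_cum subnKC //.
by apply: leq_psum => u; have [] := h i u ik.
Qed.

Lemma pattern_out i u : i <= k -> n <= u -> f i u = 0.
Proof.
move=> ik nu; have [gt _ _] := lrf.
by apply/eqP; rewrite -leqn0 -(nth_default 0 nu) (gt_pattern_le gt).
Qed.

Lemma row_cum_mono i v w : i < k -> v <= w -> row_cum f i v <= row_cum f i w.
Proof.
move=> ik /subnK<-; have [[_ _ h] _ _] := lrf; elim: (w - v) => // d IH.
have := pattern_psumS (d + v) ik; have := pattern_psumS (d + v).+1 ik.
by rewrite addSn !psumS; have := h i (d + v) ik; lia.
Qed.

Lemma row_cum_full i v : i < k -> n <= v -> mu i + row_cum f i v = la i.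
Proof.
move=> ik nv; have [_ ct _] := lrf; have := ct i ik; have := pattern_psumS v ik.
have st j w : j <= k -> n <= w -> psum (f j) w = psum (f j) n.
  by move=> jk; apply: psum_stable => u; apply: pattern_out.
by rewrite !(st _ K) // ?(st _ v) //; lia.
Qed.

Lemma row_cum_le i v : i < k -> mu i + row_cum f i v <= la i.
Proof.
move=> ik; rewrite -(row_cum_full ik (leq_maxl n v)) leq_add2l.
exact: row_cum_mono (leq_maxr n v).
Qed.

Lemma tab_ofP b v : b \in D -> (tab_of f b <= v) = (col b <= mu b.1 + row_cum f b.1 v).
Proof.
move=> bD; rewrite ffunE bD; set P := fun v => _; set x := find _ _.
have bk := ltn_ord b.1.
have cb : col b <= la b.1 by move: bD; rewrite mem_skew => /andP[].
have Pn w : n <= w -> P w by move=> nw; rewrite /P row_cum_full.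
have hP : has P (iota 0 n.+1).
  by apply/hasP; exists n; [rewrite mem_iota /= add0n|apply: Pn].
have xn : x < n.+1 by rewrite -[n.+1](size_iota 0) -has_find.
rewrite inordK // -/(P v); apply/idP/idP => [xv|Pv].
  have := nth_find 0 hP; rewrite -/x nth_iota // add0n => Px.
  by apply: leq_trans Px _; rewrite leq_add2l row_cum_mono.
rewrite leqNgt; apply/negP => vx; have := before_find 0 vx.
by rewrite nth_iota ?(ltn_trans vx) // add0n Pv.
Qed.

Lemma row_count_tab_of i v : i < k -> row_count (tab_of f) i v = row_cum f i v.
Proof.
move=> ik; have le := row_cum_le v ik; rewrite -(card_segment ik (x := row_cum f i v)).
  apply: eq_card => b; rewrite [LHS]inE [RHS]inE.
  apply/and3P/andP => [[bD /eqP e Tb]|[/eqP e /andP[h1 h2]]].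
    by move: (bD) Tb; rewrite tab_ofP // mem_skew /= e eqxx => /andP[-> _] ->.
  have bD : b \in D by rewrite mem_skew e h1 (leq_trans h2 le).
  split=> //; first by apply/eqP.
  by rewrite tab_ofP //; move: h2; rewrite -e.
exact: leq_trans le (lam i).
Qed.

Lemma tab_of_supported : supported (tab_of f).
Proof.
move=> b; case bD: (b \in D); last by rewrite ffunE bD inordK.
rewrite lt0n -leqn0 tab_ofP // /row_cum !psum0 subnn addn0.
by move: bD; rewrite mem_skew => /andP[h _]; rewrite -ltnNge h.
Qed.

Lemma psum_tab_of i v : i <= k -> psum (tab_pattern (tab_of f) i) v = psum (f i) v.
Proof.
have [[f0 _ _] _ _] := lrf.
elim: i => [|i IH] ik.
  rewrite psum_tab_pattern //; last exact: tab_of_supported.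
  rewrite (@eq_psum (f 0) (fun=> 0)); last by move=> u _.
  rewrite /psum sum_nat_const muln0; apply/eqP; rewrite cards_eq0.
  by apply/eqP/setP => b; rewrite !inE ltn0 andbF.
rewrite psum_tab_patternS //; last exact: tab_of_supported.
by rewrite IH ?(ltnW ik) // row_count_tab_of // pattern_psumS.
Qed.

Lemma tab_pattern_tab_of i u : i <= k -> tab_pattern (tab_of f) i u = f i u.
Proof.
by move=> ik; have := psum_tab_of u.+1 ik; rewrite !psumS psum_tab_of // => /addnI.
Qed.

Lemma tab_of_lr : lr_tableau (tab_of f).
Proof.
have [[f0 fk h] ct cb] := lrf.
have pT := tab_of_supported.
have rw : row_weak (tab_of f).
  move=> b b' bD b'D e cc; rewrite tab_ofP //.
  have := leqnn (tab_of f b'); rewrite tab_ofP // /= => h'.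
  by apply: leq_trans cc _; move: h'; rewrite /= in e *; rewrite e.
apply/and3P; split.
- apply/semistandardP; split=> // b b' bD b'D ec lt.
  have step i v : i.+1 < k -> mu i.+1 + row_cum f i.+1 v.+1 <= mu i + row_cum f i v.
    move=> ik; have := cb i ik v.
    by rewrite !(pattern_psumS _ ik) !(pattern_psumS _ (ltnW ik)); lia.
  have steps d i v : i + d.+1 < k ->
      mu (i + d.+1) + row_cum f (i + d.+1) v.+1 <= mu i + row_cum f i v.
    elim: d => [|d IH] ik; first by rewrite addn1 in ik *; apply: step.
    rewrite addnS in ik *; apply: leq_trans (step _ _ ik) _.
    apply: leq_trans (IH (ltnW ik)); rewrite leq_add2l row_cum_mono //; exact: ltnW.
  have T0 : 0 < tab_of f b' by rewrite -pT.
  rewrite -(prednK T0) ltnS tab_ofP // ec.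
  have := leqnn (tab_of f b'); rewrite tab_ofP // -(prednK T0) => h1.
  apply: leq_trans h1 _.
  have := steps (b'.1 - b.1.+1) b.1 (tab_of f b').-1.
  by rewrite addnS -addSn subnKC // => /(_ (ltn_ord _)).
- by apply/(has_weightP pT) => u; rewrite tab_pattern_tab_of.
apply/(ballotP pT rw) => i u ik; rewrite !tab_pattern_tab_of ?(ltnW ik) //.
by have [] := h i u ik.
Qed.

End Inverse.

Lemma lr_coef_patterns :
  lr_coef k m las mus nus = nb_patterns k K M (lr_pattern k K mu la nu).
Proof.
rewrite /lr_coef /nb_patterns.
rewrite -(card_in_imset (f := fun T => of_pat k K M (tab_pattern T))).
  apply: eq_card => g; rewrite inE; apply/imsetP/asboolP => [[T]|lrg].
    rewrite inE => lrT ->; have [lr bx] := lr_tableau_pattern lrT.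
    by rewrite of_patK.
  exists (tab_of (pat_of g)); first by rewrite inE; apply: tab_of_lr.
  rewrite -[LHS]pat_ofK; congr of_pat; apply: funext => i; apply: funext => u.
  case: (leqP i k) => ik; first by rewrite tab_pattern_tab_of.
  rewrite tab_pattern_above //.
  by have [_ ->] := pat_of_boxed g i u; rewrite // negb_and -ltnNge ik.
move=> T T'; rewrite !inE => lrT lrT' e.
have [lr bx] := lr_tableau_pattern lrT; have [lr' bx'] := lr_tableau_pattern lrT'.
have {}e : tab_pattern T = tab_pattern T' by rewrite -(of_patK bx) -(of_patK bx') e.
have /and3P[/semistandardP[pT rw _] _ _] := lrT.
have /and3P[/semistandardP[pT' rw' _] _ _] := lrT'.
have rc i v : i < k -> row_count T i v = row_count T' i v.
  by move=> ik; have := psum_tab_patternS v pT ik; rewrite e (psum_tab_patternS v pT' ik) => /addnI.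
apply/ffunP => b; apply: val_inj => /=.
case bD: (b \in D); last first.
  by have := pT b; have := pT' b; rewrite bD; case: (nat_of_ord (T b)); case: (nat_of_ord (T' b)).
apply/eqP; rewrite eqn_leq (row_countP _ rw bD) (row_countP _ rw' bD).
by rewrite rc ?ltn_ord // -(row_countP _ rw' bD) leqnn -rc ?ltn_ord // -(row_countP _ rw bD) leqnn.
Qed.

End Tableaux.

Lemma partition_nth_anti la : is_partition la ->
  forall i j, i <= j -> nth 0 la j <= nth 0 la i.
Proof.
move=> /andP[sla _] i j ij.
case: (ltnP j (size la)) => jl; last by rewrite nth_default.
have geq_trans : transitive geq by move=> x y z /= h1 h2; apply: leq_trans h2 h1.
apply: (sorted_leq_nth geq_trans (fun x => leqnn x) 0 sla) => //=.
exact: leq_ltn_trans jl.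
Qed.

Local Open Scope classical_set_scope.
Local Open Scope card_scope.
Local Open Scope nat_scope.

Theorem theorem3p1 (k n : nat) (la mu nu : seq nat)
    (hk : 0 < k) (hkn : k < n)
    (hla : is_partition la) (hmu : is_partition mu) (hnu : is_partition nu)
    (hlar : in_rectangle k (n - k) la) (hmur : in_rectangle k (n - k) mu)
    (hmula : part_included mu la) :
  ways nu (skew_diagram k (n - k) la mu) #= `I_(lr_coef k (n - k) la mu nu).
Proof.
set m := n - k in hlar hmur *.
(* [K] must be at least the number of letters for the tableaux, and at least [k] for the levels
   built by the algorithm, which have up to [k] entries. [M] bounds every part of [nu]. *)
pose K := k + size nu; pose M := sumn nu.
have nuM u : nth 0 nu u <= M.
  rewrite /M; elim: nu u {hnu K M} => [|x s IH] [|u] //=; first exact: leq_addr.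
  by apply: leq_trans (IH u) _; apply: leq_addl.
have nuK u : K <= u -> nth 0 nu u = 0.
  by move=> Ku; rewrite nth_default //; apply: leq_trans Ku; apply: leq_addl.
have mu_anti := partition_nth_anti hmu; have la_anti := partition_nth_anti hla.
have mula i : nth 0 mu i <= nth 0 la i by exact: (hmula i.+1).
have lam i : nth 0 la i <= m.
  case: (ltnP i (size la)) => il; last by rewrite nth_default.
  by case/andP: hlar => _ /allP; apply; apply: mem_nth.
have mum i : nth 0 mu i <= m by apply: leq_trans (mula i) (lam i).
have nu_pos : all (fun x => 0 < x) nu by case/andP: hnu.
rewrite (lr_coef_patterns k nuM (leq_addl k (size nu)) mu_anti la_anti mula lam).
rewrite (nb_lr_patterns_rot (C := m) nuM nuK) //; try by move=> i _.
- apply: ways_enumerated_card.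
  have -> : skew_diagram k m la mu = interval_diagram k m
      (fun q => (nth 0 mu q).+1) (fun q => nth 0 la q - nth 0 mu q).
    by apply/setP => b; rewrite !inE /part /= addSn ltnS subnKC.
  exact: (ways_lr_patterns nuM nuK nu_pos (leq_addr _ _)).
- by move=> i _; apply: mu_anti.
- by move=> i _; apply: la_anti.
Qed.
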